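(* Let $X$, $Y$ be Banach spaces with $Y$ continuously embedded in $X$, let $T\in(0,\infty]$, and assume: (a) $G$ generates a $C_0$-semigroup $(S(t))_{t\ge0}$ on $X$ such that $S(t)Y\subseteq Y$ for every $t\ge0$ and $t\mapsto S(t)y$ is continuous from $[0,\infty)$ to $Y$ for every $y\in Y$; (b) there is $\eta:(0,\infty)\to(0,\infty)$ with $\eta(\delta)\to0$ as $\delta\to0^+$ such that for all $0\le s_0<s_1$ and all $\varphi\in C([s_0,s_1],X)$, $\int_{s_0}^{s_1}S(s_1-s)\varphi(s)\,ds\in Y$ and $\bigl\|\int_{s_0}^{s_1}S(s_1-s)\varphi(s)\,ds\bigr\|_Y\le\eta(s_1-s_0)\|\varphi\|_{C([s_0,s_1],X)}$; (c) $F:[0,T)\times Y\to X$ is continuous and satisfies a Lipschitz condition in the second argument on bounded sets, uniformly in the first argument on compact intervals; (d) $X$ and $Y$ are Banach lattices, $Y$ is a sublattice of $X$, and $\mathcal D(G)$ is a dense subspace of $Y$; (e) there exists a positive linear operator $H:Y\to X$ such that for every $\gamma\ge0$ the operator $G-\gamma H$ generates a positive semigroup $(S_\gamma(t))_{t\ge0}$ on $X$ and $S_\gamma(t)Y\subseteq Y$ for all $t\ge0$; (f) for every $\tau\in[0,T)$ and every $r>0$ there exists $\gamma\ge0$ such that $F(t,v)+\gamma Hv\ge0$ for all $v\in Y_+$ with $\|v\|_Y\le r$ and all $t\in[0,\tau]$. Let $\mathring u\in Y_+$ and let $u$ be the unique maximal mild solution on $[0,t_{\max})$, $t_{\max}\in(0,T]$,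 of $u'=Gu+F(t,u)$, $u(0)=\mathring u$. Then $u(t)\ge0$ for all $t\in[0,t_{\max})$.
   Context: $F$ satisfies a Lipschitz condition in the second argument on bounded sets, uniformly in the first argument on compact intervals, if for every $t'\in[0,T)$ and $r>0$ there is $L$ with $\|F(t,f)-F(t,g)\|_X\le L\|f-g\|_Y$ for all $\|f\|_Y,\|g\|_Y\le r$, $t\in[0,t']$. A mild solution on $[0,t_1)$ is $u\in C([0,t_1),Y)$ with $u(t)=S(t)\mathring u+\int_0^tS(t-s)F(s,u(s))\,ds$ for $t\in[0,t_1)$; it is maximal if it cannot be extended to a mild solution on $[0,\tilde t_1)$ with $t_1<\tilde t_1\le T$. (Under (a)–(c) such a unique maximal mild solution exists.) A semigroup is positive if each $S(t)$ maps $X_+$ into $X_+$; an operator is positive if it maps non-negative elements to non-negative elements; $Y_+$ denotes the non-negative elements of $Y$. *)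

(* Defs.v *)
From Stdlib Require Import Reals.
From Coquelicot Require Export Coquelicot.
Open Scope R_scope.

Section Defs.

Definition linear_map {U V : NormedModule R_AbsRing} (f : U -> V) : Prop :=
  (forall x y, f (plus x y) = plus (f x) (f y)) /\
  (forall (a : R) x, f (scal a x) = scal a (f x)).

Definition is_sup {X : Type} (le : X -> X -> Prop) (x y z : X) : Prop :=
  le x z /\ le y z /\ (forall w, le x w -> le y w -> le z w).

(* (X, le) is a Banach lattice (X is complete since it is a
   CompleteNormedModule): a vector lattice whose norm is a lattice norm,
   i.e. |x| <= |y| implies ||x|| <= ||y||, where |x| = sup(x, -x). *)
Definition banach_lattice {X : NormedModule R_AbsRing} (le : X -> X -> Prop) : Prop :=
  (forall x, le x x) /\
  (forall x y z, le x y -> le y z -> le x z) /\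
  (forall x y, le x y -> le y x -> x = y) /\
  (forall x y z, le x y -> le (plus x z) (plus y z)) /\
  (forall (a : R) x y, 0 <= a -> le x y -> le (scal a x) (scal a y)) /\
  (forall x y, exists z, is_sup le x y z) /\
  (forall x y ax ay, is_sup le x (opp x) ax -> is_sup le y (opp y) ay ->
      le ax ay -> norm x <= norm y).

Definition C0_semigroup {X : NormedModule R_AbsRing} (S : R -> X -> X) : Prop :=
  (forall t, 0 <= t -> linear_map (S t) /\
      exists M : R, forall x, norm (S t x) <= M * norm x) /\
  (forall x, S 0 x = x) /\
  (forall t s x, 0 <= t -> 0 <= s -> S (t + s) x = S t (S s x)) /\
  (forall x, filterlim (fun t => S t x) (at_right 0) (locally x)).

(* The (possibly unbounded) operator A, given by its graph
   (A x l  <->  x is in D(A) and A x = l), is the generator of S. *)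
Definition generator {X : NormedModule R_AbsRing} (S : R -> X -> X)
  (A : X -> X -> Prop) : Prop :=
  forall x l, A x l <->
    filterlim (fun h => scal (/ h) (minus (S h x) x)) (at_right 0) (locally l).

Definition positive_semigroup {X : NormedModule R_AbsRing}
  (le : X -> X -> Prop) (S : R -> X -> X) : Prop :=
  forall t x, 0 <= t -> le zero x -> le zero (S t x).

(* mild solution on [0, t1) (t1 possibly +oo), with Y embedded in X via J *)
Definition mild_solution {X Y : CompleteNormedModule R_AbsRing} (J : Y -> X)
  (S : R -> X -> X) (F : R -> Y -> X) (u0 : Y) (t1 : Rbar) (u : R -> Y) : Prop :=
  (forall t, 0 <= t -> Rbar_lt t t1 ->
     filterlim u (within (fun r => 0 <= r /\ Rbar_lt r t1) (locally t))
       (locally (u t))) /\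
  (forall t, 0 <= t -> Rbar_lt t t1 ->
     J (u t) = plus (S t (J u0)) (RInt (fun s => S (t - s) (F s (u s))) 0 t)).

Definition maximal_mild_solution {X Y : CompleteNormedModule R_AbsRing}
  (J : Y -> X) (S : R -> X -> X) (F : R -> Y -> X) (T : Rbar) (u0 : Y)
  (t1 : Rbar) (u : R -> Y) : Prop :=
  mild_solution J S F u0 t1 u /\
  ~ (exists (t2 : Rbar) (v : R -> Y),
       Rbar_lt t1 t2 /\ Rbar_le t2 T /\ mild_solution J S F u0 t2 v /\
       (forall t, 0 <= t -> Rbar_lt t t1 -> v t = u t)).

End Defs.

(* Main.v *)
(** A mild solution of z' = G z + d - gam H z with z(0) >= 0 and forcing d >= 0 is
    non-negative: its primitive lies in D(G), hence solves a classical equation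
    for G - gam H, whose semigroup is positive, and this primitive is increasing.

    The mild solution u solves such an equation with d = F(t, u^+) + gam H u^+ + e,
    where e is the error of replacing u by u^+ in F(t, .) + gam H; the term
    F(t, u^+) + gam H u^+ is non-negative by (f) and |e| <= K |u^-| by the
    Lipschitz condition.  Let w solve w' = G w + |e|, w = 0 at the start of a time
    interval of length delta on which u starts non-negative.  Both w and u + w are
    non-negative by the first step, so u^- <= w and, by (b),
    |u^-|_Y <= |w|_Y <= eta(delta) K sup |u^-|_Y.  Once eta(delta) K <= 1/2 this forces
    u^- = 0, and finitely many steps of uniform length reach any t < tmax. *)

Require Import Defs.
From Stdlib Require Import Reals Lra Lia List ClassicalEpsilon FunctionalExtensionality.
From Coquelicot Require Import Coquelicot.
Open Scope R_scope.

(** * Linear identities in real vector spaces *)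

(** The semigroups of [G] and [G - gam H] are linked only through their generators, while a mild
    solution need not take values in the domain; only for its primitive can [gam H] be moved from
    the forcing into the generator. This requires [H] to commute with integrals, so [H] has to be
    bounded, and that is derived from positivity on the Banach lattice [Y].

    Differential inequalities between vectors are read through the norm of the negative part: it is
    not differentiable, but it is subadditive and continuous, so an [o(h)] bound on its growth to
    the right suffices.

    Condition (f) speaks only of non-negative [v], hence the detour through the positive part of
    [u]; the resulting error has no sign, hence its modulus as an extra forcing. The function [w]
    must be shown non-negative before [u + w], because [gam H w] is part of the forcing of [u + w].
    The radius, the Lipschitz constant and [gam] are fixed once on a compact interval inside
    [[0, tmax)], which is why one step length serves all steps. *)

Inductive mexpr : Type :=
| mvar (n : nat)
| mzero
| mplus (a b : mexpr)
| mminus (a b : mexpr)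
| mopp (a : mexpr)
| mscal (c : R) (a : mexpr).

Fixpoint mden {V : ModuleSpace R_Ring} (env : list V) (e : mexpr) : V :=
  match e with
  | mvar n => nth n env zero
  | mzero => zero
  | mplus a b => plus (mden env a) (mden env b)
  | mminus a b => minus (mden env a) (mden env b)
  | mopp a => opp (mden env a)
  | mscal c a => scal c (mden env a)
  end.

Fixpoint mcoef (e : mexpr) (i : nat) : R :=
  match e with
  | mvar n => if Nat.eqb i n then 1 else 0
  | mzero => 0
  | mplus a b => mcoef a i + mcoef b i
  | mminus a b => mcoef a i - mcoef b i
  | mopp a => - mcoef a i
  | mscal c a => c * mcoef a i
  end.

Fixpoint lincomb {V : ModuleSpace R_Ring} (env : list V) (c : nat -> R) : V :=
  match env with
  | nil => zero
  | x :: l => plus (scal (c O) x) (lincomb l (fun i => c (S i)))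
  end.

Lemma lincomb_plus {V : ModuleSpace R_Ring} (env : list V) c d :
  lincomb env (fun i => c i + d i) = plus (lincomb env c) (lincomb env d).
Proof.
  revert c d; induction env as [|x l IH]; intros c d; simpl.
  - now rewrite plus_zero_l.
  - rewrite (IH (fun i => c (S i)) (fun i => d (S i))).
    change (c O + d O) with (plus (c O : R_Ring) (d O)).
    rewrite scal_distr_r, <- !plus_assoc; f_equal.
    rewrite !plus_assoc; f_equal; apply plus_comm.
Qed.

Lemma lincomb_scal {V : ModuleSpace R_Ring} (env : list V) (a : R) c :
  lincomb env (fun i => a * c i) = scal a (lincomb env c).
Proof.
  revert c; induction env as [|x l IH]; intros c; simpl.
  - now rewrite scal_zero_r.
  - rewrite (IH (fun i => c (S i))), scal_distr_l; f_equal.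
    now rewrite scal_assoc.
Qed.

Lemma lincomb_ext {V : ModuleSpace R_Ring} (env : list V) c d :
  (forall i, c i = d i) -> lincomb env c = lincomb env d.
Proof.
  intros E; replace d with c; trivial; now apply functional_extensionality.
Qed.

Lemma lincomb_zero {V : ModuleSpace R_Ring} (env : list V) :
  lincomb env (fun _ => 0) = zero.
Proof.
  induction env as [|x l IH]; simpl; trivial.
  rewrite IH, plus_zero_r; exact (scal_zero_l (K := R_Ring) x).
Qed.

Lemma lincomb_nth {V : ModuleSpace R_Ring} (env : list V) n :
  lincomb env (fun i => if Nat.eqb i n then 1 else 0) = nth n env zero.
Proof.
  revert n; induction env as [|x l IH]; intros [|n]; simpl; trivial.
  - rewrite lincomb_zero, plus_zero_r; exact (scal_one (K := R_Ring) x).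
  - rewrite IH, (scal_zero_l (K := R_Ring) x : scal 0 x = zero).
    apply plus_zero_l.
Qed.

Lemma opp_scal_m1 {V : ModuleSpace R_Ring} (x : V) : opp x = scal (-1) x.
Proof.
  symmetry; exact (scal_opp_one (K := R_Ring) x).
Qed.

Lemma mden_lincomb {V : ModuleSpace R_Ring} (env : list V) e :
  mden env e = lincomb env (mcoef e).
Proof.
  induction e as [n| |a IHa b IHb|a IHa b IHb|a IHa|c a IHa]; simpl.
  - symmetry; apply lincomb_nth.
  - symmetry; apply lincomb_zero.
  - rewrite IHa, IHb; symmetry; apply lincomb_plus.
  - unfold minus; rewrite IHa, IHb, opp_scal_m1, <- lincomb_scal.
    etransitivity; [symmetry; apply lincomb_plus|].
    apply lincomb_ext; intros; simpl; ring.
  - rewrite IHa, opp_scal_m1, <- lincomb_scal.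
    apply lincomb_ext; intros; simpl; ring.
  - rewrite IHa; symmetry; apply lincomb_scal.
Qed.

(** A nested conjunction instead of a bounded quantifier, so that [cbn] unfolds it to one real
    equation per atom. *)
Fixpoint coef_eq (n : nat) (c d : nat -> R) : Prop :=
  match n with
  | O => True
  | S k => c O = d O /\ coef_eq k (fun i => c (S i)) (fun i => d (S i))
  end.

Lemma mden_eq {V : ModuleSpace R_Ring} (env : list V) e1 e2 :
  coef_eq (length env) (mcoef e1) (mcoef e2) -> mden env e1 = mden env e2.
Proof.
  rewrite !mden_lincomb; generalize (mcoef e1) (mcoef e2).
  induction env as [|x l IH]; intros c d; simpl; trivial.
  intros [-> E]; f_equal; now apply IH.
Qed.

Ltac atom_index x env :=
  lazymatch env with
  | cons x _ => constr:(O)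
  | cons _ ?l => let n := atom_index x l in constr:(S n)
  end.

Ltac add_atom x env :=
  lazymatch env with
  | context [cons x _] => env
  | _ => constr:(cons x env)
  end.

Ltac atoms e env :=
  lazymatch e with
  | zero => env
  | plus ?a ?b => let l := atoms a env in atoms b l
  | minus ?a ?b => let l := atoms a env in atoms b l
  | opp ?a => atoms a env
  | scal _ ?a => atoms a env
  | ?x => add_atom x env
  end.

Ltac reify e env :=
  lazymatch e with
  | zero => constr:(mzero)
  | plus ?a ?b =>
      let a' := reify a env in let b' := reify b env in constr:(mplus a' b')
  | minus ?a ?b =>
      let a' := reify a env in let b' := reify b env in constr:(mminus a' b')
  | opp ?a => let a' := reify a env in constr:(mopp a')
  | scal ?c ?a => let a' := reify a env in constr:(mscal c a')
  | ?x => let n := atom_index x env in constr:(mvar n)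
  end.

(** Proves an identity between linear combinations by comparing coefficients. Side conditions of
    [field], such as a scalar being nonzero, are left to the caller; hence the calls
    [module; lra]. *)
Ltac module :=
  lazymatch goal with
  | |- @eq ?X ?a ?b =>
      let env := atoms a (@nil X) in
      let env := atoms b env in
      let ea := reify a env in
      let eb := reify b env in
      refine (mden_eq env ea eb _);
      cbn [coef_eq mcoef length Nat.eqb]; repeat split; try ring; try field
  end.

(** * Continuity, growth and integrals *)

Section Normed.
Context {V : NormedModule R_AbsRing}.
Implicit Types (f g : R -> V) (x y z : V).

Lemma norm_le_plus x y a b : norm x <= a -> norm y <= b -> norm (plus x y) <= a + b.
Proof. intros; pose proof (norm_triangle x y); lra. Qed.

Lemma norm_le_minus x y a b : norm x <= a -> norm y <= b -> norm (minus x y) <= a + b.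
Proof. intros; apply norm_le_plus; trivial; now rewrite norm_opp. Qed.

Lemma norm_nneg x : 0 <= norm x.
Proof. apply norm_ge_0. Qed.

Lemma norm_scal_le (a : R) x : norm (scal a x) <= Rabs a * norm x.
Proof. exact (norm_scal a x). Qed.

Lemma norm_scal_nneg (a : R) x : 0 <= a -> norm (scal a x) <= a * norm x.
Proof. intros; rewrite <- (Rabs_pos_eq a) at 2 by trivial; apply norm_scal_le. Qed.

Lemma norm_minus_sym x y : norm (minus x y) = norm (minus y x).
Proof. rewrite <- (norm_opp (minus x y)); f_equal; module. Qed.

Lemma norm_minus_trans x y z a b :
  norm (minus x y) <= a -> norm (minus y z) <= b -> norm (minus x z) <= a + b.
Proof.
  intros; replace (minus x z) with (plus (minus x y) (minus y z)) by module.
  now apply norm_le_plus.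
Qed.

Lemma norm_le_of_minus x y a : norm (minus x y) <= a -> norm x <= norm y + a.
Proof.
  intros; replace x with (plus y (minus x y)) by module.
  apply norm_le_plus; lra.
Qed.

Lemma norm_minus_self x : norm (minus x x) = 0.
Proof. replace (minus x x) with (zero : V) by module; apply norm_zero. Qed.

Lemma continuous_eps f s :
  continuous f s <->
  forall eps, 0 < eps -> exists del, 0 < del /\
    forall t, Rabs (t - s) < del -> norm (minus (f t) (f s)) < eps.
Proof.
  unfold continuous; rewrite (filterlim_locally_ball_norm f (f s)); split.
  - intros H eps He; destruct (H (mkposreal eps He)) as [d Hd].
    exists d; split; [apply cond_pos|intros t Ht; exact (Hd t Ht)].
  - intros H eps; destruct (H eps (cond_pos eps)) as (d & Hd & Hf).
    exists (mkposreal d Hd); intros t Ht; exact (Hf t Ht).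
Qed.

Lemma norm_bounded_on_segment f a b :
  (forall s, continuous f s) -> exists M, 0 < M /\ forall s, a <= s <= b -> norm (f s) <= M.
Proof.
  intros H; destruct (bounded_continuity f a b) as [M HM]; [intros s _; apply H|].
  exists (Rmax 1 M); split; [pose proof (Rmax_l 1 M); lra|].
  intros s Hs; specialize (HM s Hs); pose proof (Rmax_r 1 M); lra.
Qed.

Lemma continuous_shift f c : (forall s, continuous f s) ->
  forall s, continuous (fun s => f (c + s)) s.
Proof.
  intros H s; apply continuous_comp with (f := fun s => c + s) (g := f); [|apply H].
  apply (continuous_plus (fun _ : R => c) (fun s => s)); [apply continuous_const|apply continuous_id].
Qed.

(* g q plays the role of f 0 q: continuity of f at the points (0, q) becomes uniform in q. *)
Lemma uniform_near_diagonal (f : R -> R -> V) (g : R -> V) a b :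
  (forall q0 eps, 0 < eps -> exists del, 0 < del /\ forall p q,
     Rabs p < del -> Rabs (q - q0) < del -> norm (minus (f p q) (g q0)) <= eps) ->
  (forall s, continuous g s) ->
  forall eps, 0 < eps -> exists del, 0 < del /\ forall s p q, a <= s <= b ->
    Rabs p < del -> Rabs (q - s) < del -> norm (minus (f p q) (g s)) <= eps.
Proof.
  intros Hf Hg eps He.
  (* The factor 2 leaves room for the triangle inequality: compactness gives a centre [q0] with [s]
     closer than [d q0] and [del <= d q0], so [q] is within twice [d q0] of [q0]. *)
  assert (Hd : forall q0, exists d : posreal,
    (forall p q, Rabs p < 2 * d -> Rabs (q - q0) < 2 * d ->
       norm (minus (f p q) (g q0)) <= eps / 2) /\
    (forall q, Rabs (q - q0) < d -> norm (minus (g q) (g q0)) <= eps / 2)).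
  { intros q0.
    destruct (Hf q0 (eps / 2) ltac:(lra)) as (d1 & Hd1 & H1).
    destruct (proj1 (continuous_eps g q0) (Hg q0) (eps / 2) ltac:(lra)) as (d2 & Hd2 & H2).
    assert (Hm : 0 < Rmin (d1 / 2) d2) by (apply Rmin_pos; lra).
    pose proof (Rmin_l (d1 / 2) d2); pose proof (Rmin_r (d1 / 2) d2).
    exists (mkposreal _ Hm); simpl; split.
    - intros; apply H1; lra.
    - intros; apply Rlt_le, H2; lra. }
  apply choice in Hd; destruct Hd as [d Hd].
  destruct (compactness_value_1d a b d) as [del Hdel].
  exists del; split; [apply cond_pos|]; intros s p q Hs Hp Hq.
  destruct (NNPP _ (Hdel s Hs)) as (q0 & _ & H1 & H2).
  destruct (Hd q0) as [Hd1 Hd2].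
  replace eps with (eps / 2 + eps / 2) by lra.
  apply norm_minus_trans with (g q0).
  - pose proof (cond_pos (d q0)); apply Hd1; [lra|].
    replace (q - q0) with ((q - s) + (s - q0)) by ring.
    pose proof (Rabs_triang (q - s) (s - q0)); lra.
  - rewrite norm_minus_sym; apply Hd2; trivial.
Qed.

End Normed.

Lemma continuous_pos_part s : continuous (Rmax 0) s.
Proof.
  apply (continuous_eps (V := R_NormedModule)); intros eps He; exists eps; split; trivial.
  intros t Ht; change (Rabs (Rmax 0 t - Rmax 0 s) < eps); revert Ht.
  unfold Rmax; destruct (Rle_dec 0 t), (Rle_dec 0 s); split_Rabs; lra.
Qed.

(** A continuous function whose upper right Dini derivative is nowhere positive cannot grow. Compare
    [f] with lines of slope [eps] and push the last point below the line to the right. *)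
Lemma right_growth (f : R -> R) a b : a <= b ->
  (forall s, a <= s <= b -> continuity_pt f s) ->
  (forall s eps, a <= s < b -> 0 < eps -> exists del, 0 < del /\
     forall h, 0 < h < del -> f (s + h) <= f s + h * eps) ->
  f b <= f a.
Proof.
  intros Hab Hc Hr.
  assert (K : forall eps, 0 < eps -> f b <= f a + (b - a) * eps).
  { intros eps He.
    set (E := fun s => a <= s <= b /\ f s <= f a + (s - a) * eps).
    assert (Ea : E a) by (split; lra).
    destruct (completeness E) as [m [Hub Hlub]].
    { exists b; intros s [[_ Hs] _]; exact Hs. }
    { now exists a. }
    assert (Ham : a <= m) by now apply Hub.
    assert (Hmb : m <= b) by (apply Hlub; intros s [[_ Hs] _]; exact Hs).
    assert (Em : E m).
    { split; [lra|]; apply Rnot_lt_le; intros Hlt.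
      set (gap := f m - (f a + (m - a) * eps)).
      assert (Hgap : 0 < gap) by (unfold gap; lra).
      destruct (proj1 (continuous_eps (V := R_NormedModule) f m)
        (proj1 (continuity_pt_filterlim f m) (Hc m (conj Ham Hmb))) gap Hgap) as (d & Hd & Hfd).
      assert (Hex : exists s, E s /\ m - d < s).
      { apply NNPP; intros Hno.
        assert (m <= m - d); [|lra].
        apply Hlub; intros s Hs; apply Rnot_lt_le; intros ?; apply Hno; now exists s. }
      destruct Hex as (s & Es & Hs).
      pose proof (Hub s Es) as Hsm; destruct Es as [_ Es].
      assert (Hx : Rabs (f s - f m) < gap) by (apply Hfd, Rabs_def1; lra).
      apply Rabs_def2 in Hx; unfold gap in Hx.
      assert ((s - a) * eps <= (m - a) * eps) by (apply Rmult_le_compat_r; lra).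
      lra. }
    (* If [m < b], the growth bound at [m] puts a point beyond [m] into [E]. *)
    destruct (Rle_lt_or_eq_dec _ _ Hmb) as [Hlt| ->]; [|apply Em].
    exfalso; destruct (Hr m eps (conj Ham Hlt) He) as (d & Hd & Hh).
    set (h := Rmin (d / 2) (b - m)).
    assert (Hh0 : 0 < h) by (apply Rmin_pos; lra).
    pose proof (Rmin_l (d / 2) (b - m)); pose proof (Rmin_r (d / 2) (b - m)).
    assert (m + h <= m); [|lra].
    apply Hub; split; [unfold h in *; lra|].
    specialize (Hh h ltac:(unfold h in *; lra)); destruct Em as [_ Em]; lra. }
  apply Rnot_lt_le; intros Hlt.
  (* With this slope the line rises by at most half of [f b - f a]; the [+ 1] covers [a = b]. *)
  specialize (K ((f b - f a) / (2 * (b - a + 1)))).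
  assert (Hp : 0 < (f b - f a) / (2 * (b - a + 1))) by (apply Rdiv_lt_0_compat; lra).
  specialize (K Hp).
  assert ((b - a) * ((f b - f a) / (2 * (b - a + 1))) <= (f b - f a) / 2); [|lra].
  replace ((f b - f a) / 2) with ((b - a + 1) * ((f b - f a) / (2 * (b - a + 1)))) by (field; lra).
  apply Rmult_le_compat_r; lra.
Qed.

Definition bounded_linear {U V : NormedModule R_AbsRing} (L : U -> V) : Prop :=
  linear_map L /\ exists M, forall x, norm (L x) <= M * norm x.

Section Linear.
Context {U V : NormedModule R_AbsRing} (L : U -> V).

Lemma linear_map_zero : linear_map L -> L zero = zero.
Proof.
  intros [_ H].
  replace (zero : U) with (scal 0 (zero : U)) by module; rewrite H; module.
Qed.

Lemma linear_map_opp : linear_map L -> forall x, L (opp x) = opp (L x).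
Proof.
  intros [_ H] x; replace (opp x) with (scal (-1) x) by module; rewrite H; module.
Qed.

Lemma linear_map_minus : linear_map L -> forall x y, L (minus x y) = minus (L x) (L y).
Proof.
  intros HL x y; unfold minus; rewrite (proj1 HL), linear_map_opp; trivial.
Qed.

Lemma bounded_linear_bound :
  bounded_linear L -> exists M, 0 < M /\ forall x, norm (L x) <= M * norm x.
Proof.
  intros [_ [M HM]]; exists (Rmax 1 M); split; [pose proof (Rmax_l 1 M); lra|].
  intros x; apply Rle_trans with (1 := HM x), Rmult_le_compat_r; [apply norm_nneg|apply Rmax_r].
Qed.

Lemma bounded_linear_continuous (f : R -> U) s :
  bounded_linear L -> continuous f s -> continuous (fun t => L (f t)) s.
Proof.
  intros HL; destruct (bounded_linear_bound HL) as (M & HM & HLM).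
  rewrite !continuous_eps; intros Hf eps He.
  destruct (Hf (eps / M)) as (d & Hd & Hfd); [now apply Rdiv_lt_0_compat|].
  exists d; split; trivial; intros t Ht.
  rewrite <- linear_map_minus by apply HL.
  apply Rle_lt_trans with (1 := HLM _).
  replace eps with (M * (eps / M)) by (field; lra).
  apply Rmult_lt_compat_l; auto.
Qed.

Lemma linear_Riemann_sum (f : R -> U) p :
  linear_map L -> L (Riemann_sum f p) = Riemann_sum (fun s => L (f s)) p.
Proof.
  intros HL; induction p as [x0|h p IH] using SF_cons_ind.
  - apply linear_map_zero, HL.
  - now rewrite !Riemann_sum_cons, (proj1 HL), (proj2 HL), IH.
Qed.

Lemma bounded_linear_is_RInt (f : R -> U) a b l :
  bounded_linear L -> is_RInt f a b l -> is_RInt (fun s => L (f s)) a b (L l).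
Proof.
  intros HL Hf.
  apply filterlim_ext with (f := fun p => L (scal (sign (b - a)) (Riemann_sum f p))).
  { intros p; rewrite (proj2 (proj1 HL)); now rewrite linear_Riemann_sum by apply HL. }
  apply filterlim_comp with (1 := Hf).
  destruct (bounded_linear_bound HL) as (M & HM & HLM).
  apply filterlim_locally_ball_norm; intros eps.
  apply locally_le_locally_norm.
  assert (Hp : 0 < eps / M) by (apply Rdiv_lt_0_compat; [apply cond_pos|trivial]).
  exists (mkposreal _ Hp); intros y Hy; unfold ball_norm in *; simpl in Hy.
  rewrite <- linear_map_minus by apply HL.
  apply Rle_lt_trans with (1 := HLM _).
  replace (pos eps) with (M * (eps / M)) by (field; lra).
  apply Rmult_lt_compat_l; auto.
Qed.

End Linear.

Section Integral.
Context {V : CompleteNormedModule R_AbsRing}.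
Implicit Types f g : R -> V.

Lemma ex_RInt_cont f a b : (forall s, continuous f s) -> ex_RInt f a b.
Proof. intros H; apply ex_RInt_continuous; auto. Qed.

Lemma RInt_norm_le f a b M : a <= b -> (forall s, continuous f s) ->
  (forall s, a <= s <= b -> norm (f s) <= M) -> norm (RInt f a b) <= (b - a) * M.
Proof.
  intros Hab Hf HM; apply norm_RInt_le_const with f; trivial.
  now apply (RInt_correct (V := V)), ex_RInt_cont.
Qed.

Lemma RInt_near f a b v eps : a <= b -> (forall s, continuous f s) ->
  (forall s, a <= s <= b -> norm (minus (f s) v) <= eps) ->
  norm (minus (RInt f a b) (scal (b - a) v)) <= (b - a) * eps.
Proof.
  intros Hab Hf HM.
  rewrite <- (RInt_const (V := V) a b v), <- RInt_minus;
    try apply ex_RInt_cont; trivial; [|intros; apply continuous_const].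
  apply RInt_norm_le; trivial.
  intros s; apply (continuous_minus f (fun _ => v)); [apply Hf|apply continuous_const].
Qed.

Lemma RInt_shift f c a b : (forall s, continuous f s) ->
  RInt (fun s => f (c + s)) a b = RInt f (c + a) (c + b).
Proof.
  intros Hf.
  rewrite (RInt_ext _ (fun s => scal 1 (f (1 * s + c)))).
  - rewrite RInt_comp_lin; [f_equal; ring|now apply ex_RInt_cont].
  - intros s _; replace (1 * s + c) with (c + s) by ring; module.
Qed.

Lemma RInt_between f a b c : (forall s, continuous f s) ->
  minus (RInt f a c) (RInt f a b) = RInt f b c.
Proof.
  intros Hf; rewrite <- (RInt_Chasles f a b c) by now apply ex_RInt_cont.
  module.
Qed.

Lemma RInt_right_derivative f a s eps : (forall s, continuous f s) -> 0 < eps ->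
  exists del, 0 < del /\ forall h, 0 < h < del ->
    norm (minus (minus (RInt f a (s + h)) (RInt f a s)) (scal h (f s))) <= h * eps.
Proof.
  intros Hf He.
  destruct (proj1 (continuous_eps f s) (Hf s) eps He) as (d & Hd & Hfd).
  exists d; split; trivial; intros h Hh.
  rewrite RInt_between by trivial.
  replace h with (s + h - s) at 2 3 by ring.
  apply RInt_near; trivial; [lra|].
  intros r Hr; apply Rlt_le, Hfd, Rabs_def1; lra.
Qed.

Lemma continuous_RInt_upper f a s : (forall s, continuous f s) ->
  continuous (fun t => RInt f a t) s.
Proof.
  intros Hf; apply (continuous_RInt_1 f a s (fun t => RInt f a t)).
  exists (mkposreal 1 Rlt_0_1); intros t _.
  now apply (RInt_correct (V := V)), ex_RInt_cont.
Qed.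

End Integral.

Lemma bounded_linear_RInt {U V : CompleteNormedModule R_AbsRing} (L : U -> V)
  (f : R -> U) a b : bounded_linear L -> (forall s, continuous f s) ->
  L (RInt f a b) = RInt (fun s => L (f s)) a b.
Proof.
  intros HL Hf; symmetry; apply is_RInt_unique, bounded_linear_is_RInt; trivial.
  now apply (RInt_correct (V := U)), ex_RInt_cont.
Qed.

(** * Banach lattices *)

(** [banach_lattice] only asserts that suprema exist, so one is selected by [epsilon]. *)
Definition lsup {E : NormedModule R_AbsRing} (le : E -> E -> Prop) (x y : E) : E :=
  epsilon (inhabits zero) (is_sup le x y).
Definition pos_part {E : NormedModule R_AbsRing} (le : E -> E -> Prop) (x : E) : E :=
  lsup le x zero.
Definition labs {E : NormedModule R_AbsRing} (le : E -> E -> Prop) (x : E) : E :=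
  lsup le x (opp x).
(** The distance of [x] to the positive cone: subadditive, 1-Lipschitz and zero exactly on the cone.
    It turns order statements into real inequalities. *)
Definition neg_norm {E : NormedModule R_AbsRing} (le : E -> E -> Prop) (x : E) : R :=
  norm (pos_part le (opp x)).

Section Lattice.
Context {E : NormedModule R_AbsRing} (le : E -> E -> Prop) (HL : banach_lattice le).
Implicit Types x y z : E.

Lemma le_refl x : le x x.
Proof. apply HL. Qed.

Lemma le_trans x y z : le x y -> le y z -> le x z.
Proof. apply HL. Qed.

Lemma le_plus x y a b : le x y -> le a b -> le (plus x a) (plus y b).
Proof.
  intros H1 H2; destruct HL as (_ & Ht & _ & Hp & _).
  apply Ht with (plus y a); [now apply Hp|].
  rewrite (plus_comm y a), (plus_comm y b); now apply Hp.
Qed.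

(** An inequality depends only on the difference of its sides, so every rearrangement of a known one
    is left to [module]. *)
Lemma le_of_minus_eq x y a b : le a b -> minus y x = minus b a -> le x y.
Proof.
  intros H H'.
  replace x with (plus a (minus x a)) by module.
  replace y with (plus b (minus x a)).
  - apply le_plus; [trivial|apply le_refl].
  - transitivity (plus (minus b a) x); [module|rewrite <- H'; module].
Qed.

Lemma le_minus x y : le zero (minus y x) <-> le x y.
Proof. split; intros H; apply le_of_minus_eq with (1 := H); module. Qed.

Lemma le_opp x y : le (opp x) y <-> le zero (plus x y).
Proof. split; intros H; apply le_of_minus_eq with (1 := H); module. Qed.

Lemma le_zero_opp x : le zero x <-> le (opp x) zero.
Proof. split; intros H; apply le_of_minus_eq with (1 := H); module. Qed.

Lemma nneg_plus x y : le zero x -> le zero y -> le zero (plus x y).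
Proof.
  intros; replace (zero : E) with (plus zero zero : E) by module; now apply le_plus.
Qed.

Lemma nneg_scal (a : R) x : 0 <= a -> le zero x -> le zero (scal a x).
Proof.
  intros Ha Hx; destruct HL as (_ & _ & _ & _ & Hs & _).
  replace (zero : E) with (scal a (zero : E)) by module; now apply Hs.
Qed.

Lemma lsup_spec x y : is_sup le x y (lsup le x y).
Proof. unfold lsup; apply epsilon_spec, HL. Qed.

Lemma le_pos_part x : le x (pos_part le x).
Proof. apply lsup_spec. Qed.

Lemma pos_part_nneg x : le zero (pos_part le x).
Proof. apply lsup_spec. Qed.

Lemma pos_part_least x y : le x y -> le zero y -> le (pos_part le x) y.
Proof. apply lsup_spec. Qed.

Lemma le_labs x : le x (labs le x).
Proof. apply lsup_spec. Qed.

Lemma le_opp_labs x : le (opp x) (labs le x).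
Proof. apply lsup_spec. Qed.

Lemma labs_least x y : le x y -> le (opp x) y -> le (labs le x) y.
Proof. apply lsup_spec. Qed.

Lemma labs_nneg x : le zero (labs le x).
Proof.
  replace (labs le x) with (scal (/2) (minus (plus (labs le x) (labs le x)) (plus x (opp x)))) by module.
  apply nneg_scal; [lra|]; apply le_minus, le_plus; [apply le_labs|apply le_opp_labs].
Qed.

Lemma is_sup_of_nneg x : le zero x -> is_sup le x (opp x) x.
Proof.
  intros H; split; [apply le_refl|split; [|trivial]].
  apply le_trans with zero; [now apply le_zero_opp|trivial].
Qed.

Lemma norm_le_of_labs x y : le (labs le x) (labs le y) -> norm x <= norm y.
Proof.
  destruct HL as (_ & _ & _ & _ & _ & _ & Hn).
  apply Hn; apply lsup_spec.
Qed.

Lemma norm_le_of_dominated x y : le x (labs le y) -> le (opp x) (labs le y) -> norm x <= norm y.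
Proof. intros; apply norm_le_of_labs; now apply labs_least. Qed.

Lemma labs_of_nneg x : le zero x -> labs le x = x.
Proof.
  intros Hx; destruct HL as (_ & _ & Ha & _); apply Ha.
  - apply labs_least; [apply le_refl|apply (is_sup_of_nneg x Hx)].
  - apply le_labs.
Qed.

Lemma norm_le_of_nneg x y : le zero x -> le x y -> norm x <= norm y.
Proof.
  intros Hx Hxy; apply norm_le_of_labs; rewrite !labs_of_nneg; trivial.
  now apply le_trans with x.
Qed.

Lemma norm_labs_le x : norm (labs le x) <= norm x.
Proof.
  apply norm_le_of_labs; rewrite labs_of_nneg; [apply le_refl|apply labs_nneg].
Qed.

Lemma norm_pos_part_le x : norm (pos_part le x) <= norm x.
Proof.
  apply norm_le_of_labs; rewrite labs_of_nneg by apply pos_part_nneg.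
  apply pos_part_least; [apply le_labs|apply labs_nneg].
Qed.

Lemma le_plus_labs x y : le x (plus y (labs le (minus x y))).
Proof. apply le_of_minus_eq with (1 := le_labs (minus x y)); module. Qed.

Lemma pos_part_le_plus x y : le (pos_part le x) (plus (pos_part le y) (labs le (minus x y))).
Proof.
  apply pos_part_least; [|apply nneg_plus; [apply pos_part_nneg|apply labs_nneg]].
  apply le_trans with (1 := le_plus_labs x y), le_plus; [apply le_pos_part|apply le_refl].
Qed.

Lemma labs_opp x : labs le (opp x) = labs le x.
Proof.
  destruct HL as (_ & _ & Ha & _); apply Ha; apply labs_least.
  - apply le_opp_labs.
  - replace (opp (opp x)) with x by module; apply le_labs.
  - replace x with (opp (opp x)) at 1 by module; apply le_opp_labs.
  - apply le_labs.
Qed.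

Lemma labs_minus_sym x y : labs le (minus x y) = labs le (minus y x).
Proof. rewrite <- labs_opp; f_equal; module. Qed.

Lemma pos_part_lipschitz x y :
  norm (minus (pos_part le x) (pos_part le y)) <= norm (minus x y).
Proof.
  apply norm_le_of_dominated.
  - apply le_of_minus_eq with (1 := pos_part_le_plus x y); module.
  - rewrite labs_minus_sym.
    apply le_of_minus_eq with (1 := pos_part_le_plus y x); module.
Qed.

Lemma labs_le_plus x y : le (labs le x) (plus (labs le y) (labs le (minus x y))).
Proof.
  apply labs_least.
  - apply le_trans with (1 := le_plus_labs x y), le_plus; [apply le_labs|apply le_refl].
  - rewrite labs_minus_sym.
    apply le_trans with (plus (opp y) (labs le (minus y x))).
    + apply le_of_minus_eq with (1 := le_labs (minus y x)); module.
    + apply le_plus; [apply le_opp_labs|apply le_refl].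
Qed.

Lemma labs_lipschitz x y : norm (minus (labs le x) (labs le y)) <= norm (minus x y).
Proof.
  apply norm_le_of_dominated.
  - apply le_of_minus_eq with (1 := labs_le_plus x y); module.
  - rewrite labs_minus_sym.
    apply le_of_minus_eq with (1 := labs_le_plus y x); module.
Qed.

(** Each inequality is the leastness of one positive part: [x^+ - x] bounds [-x] and zero, and
    [x + x^-] bounds [x] and zero. *)
Lemma minus_pos_part x : minus x (pos_part le x) = opp (pos_part le (opp x)).
Proof.
  destruct HL as (_ & _ & Ha & _); apply Ha.
  - apply le_of_minus_eq with (pos_part le (opp x)) (minus (pos_part le x) x); [|module].
    apply pos_part_least.
    + apply le_of_minus_eq with (1 := pos_part_nneg x); module.
    + apply le_minus, le_pos_part.
  - apply le_of_minus_eq with (pos_part le x) (plus x (pos_part le (opp x))); [|module].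
    apply pos_part_least.
    + apply le_of_minus_eq with (1 := pos_part_nneg (opp x)); module.
    + apply le_of_minus_eq with (1 := le_pos_part (opp x)); module.
Qed.

Lemma neg_norm_nneg x : 0 <= neg_norm le x.
Proof. apply norm_nneg. Qed.

Lemma neg_norm_of_nneg x : le zero x -> neg_norm le x = 0.
Proof.
  intros Hx; unfold neg_norm; replace (pos_part le (opp x)) with (zero : E); [apply norm_zero|].
  destruct HL as (_ & _ & Ha & _); apply Ha; [apply pos_part_nneg|].
  apply pos_part_least; [now apply le_zero_opp|apply le_refl].
Qed.

Lemma nneg_of_neg_norm x : neg_norm le x <= 0 -> le zero x.
Proof.
  intros H; assert (H0 : neg_norm le x = 0) by (pose proof (neg_norm_nneg x); lra).
  apply norm_eq_zero in H0; apply le_zero_opp; rewrite <- H0; apply le_pos_part.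
Qed.

Lemma neg_norm_le_norm x : neg_norm le x <= norm x.
Proof. rewrite <- (norm_opp x); apply norm_pos_part_le. Qed.

Lemma neg_norm_plus x y : neg_norm le (plus x y) <= neg_norm le x + neg_norm le y.
Proof.
  apply Rle_trans with (2 := norm_triangle _ _), norm_le_of_nneg; [apply pos_part_nneg|].
  apply pos_part_least; [|apply nneg_plus; apply pos_part_nneg].
  replace (opp (plus x y)) with (plus (opp x) (opp y)) by module.
  apply le_plus; apply le_pos_part.
Qed.

Lemma neg_norm_lipschitz x y : Rabs (neg_norm le x - neg_norm le y) <= norm (minus x y).
Proof.
  pose proof (neg_norm_plus y (minus x y)) as H1.
  pose proof (neg_norm_plus x (minus y x)) as H2.
  replace (plus y (minus x y)) with x in H1 by module.
  replace (plus x (minus y x)) with y in H2 by module.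
  pose proof (neg_norm_le_norm (minus x y)).
  pose proof (neg_norm_le_norm (minus y x)) as H3.
  rewrite norm_minus_sym in H3; apply Rabs_le; lra.
Qed.

Lemma continuity_neg_norm (f : R -> E) s :
  continuous f s -> continuity_pt (fun t => neg_norm le (f t)) s.
Proof.
  intros Hf; apply continuity_pt_filterlim.
  apply (continuous_eps (V := R_NormedModule) (fun t => neg_norm le (f t))).
  intros eps He; destruct (proj1 (continuous_eps f s) Hf eps He) as (d & Hd & Hfd).
  exists d; split; trivial; intros t Ht.
  exact (Rle_lt_trans _ _ _ (neg_norm_lipschitz _ _) (Hfd t Ht)).
Qed.

Lemma nneg_closed x :
  (forall eps, 0 < eps -> exists y, le zero y /\ norm (minus x y) <= eps) -> le zero x.
Proof.
  intros H; apply nneg_of_neg_norm, Rnot_lt_le; intros Hlt.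
  destruct (H (neg_norm le x / 2) ltac:(lra)) as (y & Hy & Hxy).
  pose proof (neg_norm_plus y (minus x y)) as H1.
  replace (plus y (minus x y)) with x in H1 by module.
  pose proof (neg_norm_le_norm (minus x y)).
  rewrite (neg_norm_of_nneg y Hy) in H1; lra.
Qed.

(** For positive [L], the negative part of [L x] lies below [L (x^-)]. *)
Lemma neg_norm_positive_map (L : E -> E) M : 0 <= M -> linear_map L ->
  (forall x, norm (L x) <= M * norm x) -> (forall x, le zero x -> le zero (L x)) ->
  forall x, neg_norm le (L x) <= M * neg_norm le x.
Proof.
  intros HM Hlin Hb Hp x; apply Rle_trans with (2 := Hb _).
  apply norm_le_of_nneg; [apply pos_part_nneg|].
  apply pos_part_least; [|apply Hp, pos_part_nneg].
  rewrite <- (linear_map_opp L Hlin).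
  apply le_minus; rewrite <- (linear_map_minus L Hlin).
  apply Hp, le_minus, le_pos_part.
Qed.

Lemma continuous_pos_part_comp (f : R -> E) s :
  continuous f s -> continuous (fun t => pos_part le (f t)) s.
Proof.
  rewrite !continuous_eps; intros Hf eps He; destruct (Hf eps He) as (d & Hd & Hfd).
  exists d; split; trivial; intros t Ht.
  exact (Rle_lt_trans _ _ _ (pos_part_lipschitz _ _) (Hfd t Ht)).
Qed.

Lemma continuous_labs_comp (f : R -> E) s :
  continuous f s -> continuous (fun t => labs le (f t)) s.
Proof.
  rewrite !continuous_eps; intros Hf eps He; destruct (Hf eps He) as (d & Hd & Hfd).
  exists d; split; trivial; intros t Ht.
  exact (Rle_lt_trans _ _ _ (labs_lipschitz _ _) (Hfd t Ht)).
Qed.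

End Lattice.

(** The integral over [[s, s + h]] is [h d(s)], a non-negative vector, up to [o(h)]; by
    subadditivity [neg_norm] of the integral satisfies [right_growth], starting from zero. *)
Lemma nneg_RInt {E : CompleteNormedModule R_AbsRing} (le : E -> E -> Prop) (d : R -> E) a b :
  banach_lattice le -> a <= b -> (forall s, continuous d s) ->
  (forall s, a <= s <= b -> le zero (d s)) -> le zero (RInt d a b).
Proof.
  intros HL Hab Hd Hp; apply (nneg_of_neg_norm le HL).
  assert (H0 : neg_norm le (RInt d a a) = 0).
  { rewrite RInt_point; apply (neg_norm_of_nneg le HL), (le_refl le HL). }
  rewrite <- H0.
  apply (right_growth (fun s => neg_norm le (RInt d a s))); trivial.
  - intros s _; apply (continuity_neg_norm le HL); now apply continuous_RInt_upper.
  - intros s eps Hs He.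
    destruct (RInt_right_derivative d a s eps Hd He) as (del & Hdel & Hh).
    exists del; split; trivial; intros h H; specialize (Hh h H).
    set (r := minus (minus (RInt d a (s + h)) (RInt d a s)) (scal h (d s))) in Hh.
    replace (RInt d a (s + h)) with (plus (RInt d a s) (plus (scal h (d s)) r)) by (unfold r; module).
    apply Rle_trans with (1 := neg_norm_plus le HL _ _), Rplus_le_compat_l.
    apply Rle_trans with (1 := neg_norm_plus le HL _ _).
    rewrite (neg_norm_of_nneg le HL (scal h (d s))) by (apply (nneg_scal le HL); [lra|apply Hp; lra]).
    pose proof (neg_norm_le_norm le HL r); lra.
Qed.

(** * Uniform boundedness *)

Lemma halving_small (r : nat -> R) : (forall n, r (S n) <= r n / 2) ->
  forall eps, 0 < eps -> exists N, forall n, (N <= n)%nat -> r n < eps.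
Proof.
  intros Hr eps He.
  assert (H : forall n, r n <= Rabs (r O) * (/2) ^ n).
  { induction n as [|n IH]; simpl; [rewrite Rmult_1_r; apply Rle_abs|].
    specialize (Hr n); lra. }
  destruct (pow_lt_1_zero (/2) ltac:(rewrite Rabs_pos_eq; lra) (eps / (Rabs (r O) + 1)))
    as [N HN].
  { apply Rdiv_lt_0_compat; [trivial|pose proof (Rabs_pos (r O)); lra]. }
  exists N; intros n Hn; specialize (HN n Hn); apply Rle_lt_trans with (1 := H n).
  rewrite Rabs_pos_eq in HN by (apply pow_le; lra).
  pose proof (Rabs_pos (r O)).
  apply Rle_lt_trans with ((Rabs (r O) + 1) * (/2) ^ n).
  - apply Rmult_le_compat_r; [apply pow_le|]; lra.
  - replace eps with ((Rabs (r O) + 1) * (eps / (Rabs (r O) + 1))) by (field; lra).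
    apply Rmult_lt_compat_l; lra.
Qed.

Definition sequentially_complete (X : NormedModule R_AbsRing) : Prop :=
  forall x : nat -> X,
    (forall eps, 0 < eps -> exists N, forall n m, (N <= n)%nat -> (N <= m)%nat ->
       norm (minus (x n) (x m)) < eps) ->
    exists l, forall eps, 0 < eps -> exists N, forall n, (N <= n)%nat ->
      norm (minus (x n) l) < eps.

Lemma complete_sequentially (X : CompleteNormedModule R_AbsRing) : sequentially_complete X.
Proof.
  intros x Hx.
  destruct (proj1 (filterlim_locally_cauchy (F := eventually) x)) as [l Hl].
  - intros eps; destruct (Hx eps (cond_pos eps)) as [N HN].
    exists (fun n => (N <= n)%nat); split; [now exists N|].
    intros n m Hn Hm; apply (norm_compat1 (x n) (x m) eps); now apply HN.
  - exists l; intros eps He.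
    destruct (proj1 (filterlim_locally_ball_norm x l) Hl (mkposreal eps He)) as [N HN].
    exists N; exact HN.
Qed.

Lemma nested_balls {X : NormedModule R_AbsRing} (HX : sequentially_complete X)
  (x : nat -> X) (r : nat -> R) :
  (forall n, 0 < r n) -> (forall n, norm (minus (x (S n)) (x n)) <= r n / 2) ->
  (forall n, r (S n) <= r n / 2) -> exists l, forall n, norm (minus l (x n)) <= r n.
Proof.
  intros Hr0 Hx Hr.
  (* The n-th step has length at most [r n / 2 <= r n - r (S n)], so the distances telescope. *)
  assert (Hk : forall n k, norm (minus (x (n + k)%nat) (x n)) <= r n - r (n + k)%nat).
  { intros n k; induction k as [|k IH].
    - rewrite Nat.add_0_r, (norm_minus_self (x n)); lra.
    - rewrite Nat.add_succ_r; specialize (Hx (n + k)%nat); specialize (Hr (n + k)%nat).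
      pose proof (norm_minus_trans _ _ _ _ _ Hx IH); lra. }
  assert (Hnm : forall n m, (n <= m)%nat -> norm (minus (x m) (x n)) <= r n).
  { intros n m H; replace m with (n + (m - n))%nat by lia.
    specialize (Hk n (m - n)%nat); pose proof (Hr0 (n + (m - n))%nat); lra. }
  destruct (HX x) as [l Hl].
  - intros eps He; destruct (halving_small r Hr (eps / 2) ltac:(lra)) as [N HN].
    exists N; intros n m Hn Hm; specialize (HN N (le_n N)).
    pose proof (Hnm N n Hn) as H1; pose proof (Hnm N m Hm) as H2.
    rewrite norm_minus_sym in H2; pose proof (norm_minus_trans _ _ _ _ _ H1 H2); lra.
  - exists l; intros n; apply Rnot_lt_le; intros Hlt.
    destruct (Hl (norm (minus l (x n)) - r n) ltac:(lra)) as [N HN].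
    specialize (HN (Nat.max N n) ltac:(lia)); rewrite norm_minus_sym in HN.
    pose proof (norm_minus_trans _ _ _ _ _ (Rle_refl _) (Hnm n (Nat.max N n) ltac:(lia)) :
      norm (minus l (x n)) <= _); lra.
Qed.

(** Without a common bound there are nested balls such that on ball [S n] some [L i] exceeds [n]
    throughout; their common point contradicts the pointwise bound. *)
Lemma uniform_boundedness {I : Type} {X V : NormedModule R_AbsRing}
  (HX : sequentially_complete X) (L : I -> X -> V) :
  (forall i, bounded_linear (L i)) ->
  (forall x, exists M, forall i, norm (L i x) <= M) ->
  exists M, forall i x, norm (L i x) <= M * norm x.
Proof.
  intros HL Hpt; apply NNPP; intros Hno.
  assert (Hbig : forall M, exists i x, M * norm x < norm (L i x)).
  { intros M; apply NNPP; intros H; apply Hno; exists M; intros i x.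
    apply Rnot_lt_le; intros ?; apply H; now exists i, x. }
  assert (Hstep : forall (p : nat * (X * posreal)), exists q : X * posreal,
    norm (minus (fst q) (fst (snd p))) <= snd (snd p) / 2 /\ snd q <= snd (snd p) / 2 /\
    exists i, forall y, norm (minus y (fst q)) <= snd q -> INR (fst p) < norm (L i y)).
  { intros [n [x r]]; simpl.
    pose proof (cond_pos r) as Hr; pose proof (pos_INR n) as Hn.
    (* Chosen so that [xi], rescaled to norm [r / 2], has an image of norm above [2 n + 2]. *)
    destruct (Hbig ((2 * INR n + 2) / (r / 2))) as (i & xi & Hxi).
    destruct (HL i) as [Hlin _].
    assert (Hpos : 0 < norm xi).
    { pose proof (norm_nneg xi); apply Rnot_le_lt; intros Hle.
      assert (H0 : norm xi = 0) by lra.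
      rewrite H0, (norm_eq_zero xi H0), (linear_map_zero _ Hlin), norm_zero in Hxi; lra. }
    set (a := r / 2 / norm xi).
    assert (Ha : 0 < a) by (apply Rdiv_lt_0_compat; lra).
    assert (Hbigxi : 2 * INR n + 2 < norm (L i (scal a xi))).
    { apply Rmult_lt_compat_l with (r := a) in Hxi; trivial.
      replace (a * ((2 * INR n + 2) / (r / 2) * norm xi)) with (2 * INR n + 2) in Hxi
        by (unfold a; field; lra).
      apply Rlt_le_trans with (1 := Hxi).
      assert (Hs : norm (scal (/ a) (L i (scal a xi))) <= / a * norm (L i (scal a xi))).
      { apply norm_scal_nneg; left; now apply Rinv_0_lt_compat. }
      replace (scal (/ a) (L i (scal a xi))) with (L i xi) in Hs
        by (rewrite (proj2 Hlin); module; lra).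
      apply Rmult_le_compat_l with (r := a) in Hs; [|lra].
      rewrite <- Rmult_assoc, Rinv_r, Rmult_1_l in Hs; lra. }
    (* If [L i] is at most [n + 1] at [x], then at [x + a xi] it exceeds [(2 n + 2) - (n + 1)]. *)
    assert (Hx' : exists x', norm (minus x' x) <= r / 2 /\ INR n + 1 < norm (L i x')).
    { destruct (Rlt_dec (INR n + 1) (norm (L i x))) as [H|H].
      - exists x; rewrite norm_minus_self; split; lra.
      - exists (plus x (scal a xi)); split.
        + replace (minus (plus x (scal a xi)) x) with (scal a xi) by module.
          apply Rle_trans with (a * norm xi); [apply norm_scal_nneg; lra|].
          right; unfold a; field; lra.
        + rewrite (proj1 Hlin).
          assert (norm (L i (scal a xi)) <= norm (plus (L i x) (L i (scal a xi))) + norm (L i x)); [|lra].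
          replace (L i (scal a xi)) with (minus (plus (L i x) (L i (scal a xi))) (L i x)) at 1 by module.
          apply norm_le_minus; lra. }
    destruct Hx' as (x' & Hx'1 & Hx'2).
    destruct (bounded_linear_bound _ (HL i)) as (B & HB & HBi).
    (* On a ball of radius [/ B] the value of [L i] varies by at most 1, so more than [n]
       remains. *)
    assert (Hr' : 0 < Rmin (r / 2) (/ B)).
    { apply Rmin_pos; [lra|now apply Rinv_0_lt_compat]. }
    exists (x', mkposreal _ Hr'); simpl; repeat split; trivial; [apply Rmin_l|].
    exists i; intros y Hy.
    assert (Hd : norm (L i (minus x' y)) <= 1).
    { apply Rle_trans with (1 := HBi _).
      rewrite <- (Rinv_r B) by lra; apply Rmult_le_compat_l; [lra|].
      rewrite norm_minus_sym; apply Rle_trans with (1 := Hy), Rmin_r. }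
    rewrite (linear_map_minus _ Hlin) in Hd; apply norm_le_of_minus in Hd; lra. }
  apply choice in Hstep; destruct Hstep as [step Hstep].
  set (p := fix p n := match n with
                       | O => (zero, mkposreal 1 Rlt_0_1)
                       | S k => step (k, p k)
                       end).
  destruct (nested_balls HX (fun n => fst (p n)) (fun n => snd (p n))) as [l Hl].
  - intros n; apply cond_pos.
  - intros n; apply (Hstep (n, p n)).
  - intros n; apply (Hstep (n, p n)).
  - destruct (Hpt l) as [M HM]; destruct (INR_unbounded M) as [n Hn].
    destruct (Hstep (n, p n)) as (_ & _ & i & Hi).
    specialize (Hi l (Hl (S n))); specialize (HM i); simpl in Hi; lra.
Qed.

(** Positivity makes [H] monotone, so [|y| <= z] gives [|H y| <= H z], and the lattice norm compares
    them. *)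
Lemma norm_positive_operator_le {X Y : NormedModule R_AbsRing} (leX : X -> X -> Prop)
  (leY : Y -> Y -> Prop) (H : Y -> X) : banach_lattice leX -> banach_lattice leY ->
  linear_map H -> (forall y, leY zero y -> leX zero (H y)) ->
  forall y z, leY y z -> leY (opp y) z -> norm (H y) <= norm (H z).
Proof.
  intros HX HY HH Hp y z H1 H2.
  assert (Hm : forall y, leY y z -> leX (H y) (H z)).
  { intros y' Hy; apply (le_minus leX HX); rewrite <- (linear_map_minus _ HH).
    now apply Hp, (le_minus leY HY). }
  assert (Hz : leX zero (H z)).
  { apply Hp; apply (le_trans leY HY) with (labs leY y); [apply labs_nneg; trivial|].
    now apply labs_least. }
  apply (norm_le_of_dominated leX HX); rewrite (labs_of_nneg leX HX) by trivial; [auto|].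
  rewrite <- (linear_map_opp _ HH); auto.
Qed.

(* If H were unbounded, the sum of suitable small non-negative y_n would
   dominate every y_n although |H y_n| tends to infinity. *)
Lemma positive_operator_bounded {X Y : NormedModule R_AbsRing} (HY0 : sequentially_complete Y)
  (leX : X -> X -> Prop) (leY : Y -> Y -> Prop) (H : Y -> X) :
  banach_lattice leX -> banach_lattice leY ->
  linear_map H -> (forall y, leY zero y -> leX zero (H y)) -> bounded_linear H.
Proof.
  intros HX HY HH Hp; split; trivial; apply NNPP; intros Hno.
  pose proof (norm_positive_operator_le leX leY H HX HY HH Hp) as Hmon.
  (* The bound is half the radius [(/2) ^ n] with which [nested_balls] will sum the [y n]. Passing
     to the modulus makes the vector non-negative without decreasing the norm of its image. *)
  assert (Hy : forall n : nat, exists y, leY zero y /\ norm y <= (/2) ^ n / 2 /\ INR n < norm (H y)).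
  { intros n; pose proof (pow_lt (/2) n ltac:(lra)) as Hpw.
    assert (Hex : exists y, INR n / ((/2) ^ n / 2) * norm y < norm (H y)).
    { apply NNPP; intros Hn; apply Hno; exists (INR n / ((/2) ^ n / 2)); intros y.
      apply Rnot_lt_le; intros ?; apply Hn; now exists y. }
    destruct Hex as [y Hy].
    assert (Hpos : 0 < norm y).
    { pose proof (norm_nneg y); apply Rnot_le_lt; intros Hle.
      assert (Hz : norm y = 0) by lra.
      rewrite Hz, (norm_eq_zero y Hz), (linear_map_zero _ HH), norm_zero in Hy; lra. }
    set (a := (/2) ^ n / 2 / norm y).
    assert (Ha : 0 < a) by (apply Rdiv_lt_0_compat; lra).
    exists (scal a (labs leY y)); repeat split.
    - apply (nneg_scal leY HY); [lra|now apply labs_nneg].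
    - apply Rle_trans with (a * norm (labs leY y)); [apply norm_scal_nneg; lra|].
      apply Rle_trans with (a * norm y); [apply Rmult_le_compat_l; [lra|now apply norm_labs_le]|].
      right; unfold a; field; lra.
    - assert (Hs : norm (scal (/ a) (H (scal a (labs leY y)))) <= / a * norm (H (scal a (labs leY y)))).
      { apply norm_scal_nneg; left; now apply Rinv_0_lt_compat. }
      replace (scal (/ a) (H (scal a (labs leY y)))) with (H (labs leY y)) in Hs
        by (rewrite (proj2 HH); module; lra).
      pose proof (Hmon y (labs leY y) (le_labs leY HY y) (le_opp_labs leY HY y)).
      apply Rmult_lt_reg_l with (/ a); [now apply Rinv_0_lt_compat|].
      replace (/ a * INR n) with (INR n / ((/2) ^ n / 2) * norm y); [lra|].
      unfold a; generalize ((/2) ^ n) Hpw; intros q Hq; field; lra. }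
  apply choice in Hy; destruct Hy as [y Hy].
  set (x := fix x n := match n with O => zero | S k => plus (x k) (y k) end).
  destruct (nested_balls HY0 x (fun n => (/2) ^ n)) as [l Hl].
  { intros n; apply pow_lt; lra. }
  { intros n; simpl; replace (minus (plus (x n) (y n)) (x n)) with (y n) by module; apply Hy. }
  { intros n; simpl; lra. }
  assert (Hx0 : forall n, leY zero (x n)).
  { induction n as [|n IH]; simpl; [apply le_refl; trivial|apply nneg_plus; trivial; apply Hy]. }
  assert (Hyx : forall n k, leY (y n) (x (S n + k)%nat)).
  { intros n k; induction k as [|k IH].
    - rewrite Nat.add_0_r; simpl.
      replace (y n) with (plus zero (y n)) at 1 by module; apply (le_plus leY HY); trivial.
      apply le_refl; trivial.
    - rewrite Nat.add_succ_r; simpl in IH |- *.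
      replace (y n) with (plus (y n) zero) by module; apply (le_plus leY HY); trivial; apply Hy. }
  (* [y n] lies below all later partial sums, hence below their limit, since the cone is closed. *)
  assert (Hyl : forall n, leY (y n) l).
  { intros n; apply (le_minus leY HY), (nneg_closed leY HY); intros eps He.
    destruct (halving_small (fun n => (/2) ^ n) ltac:(intros; simpl; lra) eps He) as [N HN].
    exists (minus (x (S n + N)%nat) (y n)); split; [now apply (le_minus leY HY)|].
    replace (minus (minus l (y n)) (minus (x (S n + N)%nat) (y n)))
      with (minus l (x (S n + N)%nat)) by module.
    apply Rle_trans with (1 := Hl _); left; apply HN; lia. }
  destruct (INR_unbounded (norm (H l))) as [n Hn].
  pose proof (Hmon (y n) l (Hyl n)) as Hm.
  assert (leY (opp (y n)) l).
  { apply (le_trans leY HY) with zero; [apply (le_zero_opp leY HY), Hy|].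
    apply (le_trans leY HY) with (2 := Hyl n); apply Hy. }
  pose proof (proj2 (proj2 (Hy n))); specialize (Hm ltac:(trivial)); lra.
Qed.

(** * Strongly continuous semigroups *)

Lemma at_right_eps {V : NormedModule R_AbsRing} (f : R -> V) (l : V) :
  filterlim f (at_right 0) (locally l) <->
  forall eps, 0 < eps -> exists del, 0 < del /\
    forall h, 0 < h < del -> norm (minus (f h) l) < eps.
Proof.
  rewrite (filterlim_locally_ball_norm f l); split.
  - intros H eps He; destruct (H (mkposreal eps He)) as [d Hd].
    exists d; split; [apply cond_pos|]; intros h Hh; apply (Hd h); [|lra].
    change (Rabs (h - 0) < d); rewrite Rminus_0_r, Rabs_pos_eq; lra.
  - intros H eps; destruct (H eps (cond_pos eps)) as (d & Hd & Hf).
    exists (mkposreal d Hd); intros h Hh Hpos; apply Hf; split; trivial.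
    change (Rabs (h - 0) < d) in Hh; rewrite Rminus_0_r, Rabs_pos_eq in Hh; lra.
Qed.

(* Extended by the identity to t < 0, so that convolution integrands are continuous on R. *)
Definition sg_ext {X : NormedModule R_AbsRing} (Sg : R -> X -> X) (t : R) : X -> X :=
  Sg (Rmax 0 t).

Lemma finite_bound (f : nat -> R) N : exists M, forall n, (n < N)%nat -> f n <= M.
Proof.
  induction N as [|N [M HM]]; [exists 0; intros; lia|].
  exists (Rmax M (f N)); intros n Hn; destruct (Nat.eq_dec n N) as [->|Hne]; [apply Rmax_r|].
  apply Rle_trans with (2 := Rmax_l _ _), HM; lia.
Qed.

Section Semigroup.
Context {X : NormedModule R_AbsRing} (HX : sequentially_complete X).
Context (Sg : R -> X -> X) (HS : C0_semigroup Sg).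

Lemma sg_bounded_linear t : 0 <= t -> bounded_linear (Sg t).
Proof. intros; now apply HS. Qed.

Lemma sg_right_continuous x eps : 0 < eps ->
  exists del, 0 < del /\ forall t, 0 <= t < del -> norm (minus (Sg t x) x) < eps.
Proof.
  intros He; destruct HS as (_ & H0 & _ & Hc).
  destruct (proj1 (at_right_eps _ x) (Hc x) eps He) as (d & Hd & Hh).
  exists d; split; trivial; intros t Ht.
  destruct (Rle_lt_or_eq_dec 0 t ltac:(lra)) as [Hp| <-]; [apply Hh; lra|].
  now rewrite H0, norm_minus_self.
Qed.

(** Strong continuity bounds each orbit near zero, but not the operators. If every [[0, / (n + 1)]]
    failed to have the bound [n + 1], the operators at the offending times would contradict uniform
    boundedness. *)
Lemma sg_bounded_near_zero : exists del M, 0 < del /\ 0 < M /\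
  forall t x, 0 <= t <= del -> norm (Sg t x) <= M * norm x.
Proof.
  apply NNPP; intros Hno.
  assert (Hn : forall n : nat, exists t, 0 <= t <= / (INR n + 1) /\
     exists x, (INR n + 1) * norm x < norm (Sg t x)).
  { intros n; apply NNPP; intros H; apply Hno; exists (/ (INR n + 1)), (INR n + 1).
    pose proof (pos_INR n); repeat split; [apply Rinv_0_lt_compat; lra|lra|].
    intros t x Ht; apply Rnot_lt_le; intros ?; apply H; exists t; split; trivial; now exists x. }
  apply choice in Hn; destruct Hn as [t Ht].
  destruct (uniform_boundedness HX (fun n => Sg (t n))) as [M HM].
  - intros n; apply sg_bounded_linear, Ht.
  - intros x; destruct (sg_right_continuous x 1 Rlt_0_1) as (d & Hd & Hx).
    (* From [N] on, [t n < d] keeps the orbit within 1 of [x]; finitely many indices remain. *)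
    destruct (INR_unbounded (/ d)) as [N HN].
    destruct (finite_bound (fun n => norm (Sg (t n) x)) N) as [M HM].
    exists (Rmax M (norm x + 1)); intros n; destruct (Nat.le_gt_cases N n) as [Hle|Hlt].
    + apply Rle_trans with (2 := Rmax_r _ _), norm_le_of_minus, Rlt_le, Hx.
      destruct (Ht n) as [[Ht1 Ht2] _]; split; trivial.
      apply Rle_lt_trans with (1 := Ht2).
      apply le_INR in Hle; pose proof (Rinv_0_lt_compat d Hd).
      rewrite <- (Rinv_inv d); apply Rinv_lt_contravar; [apply Rmult_lt_0_compat|]; lra.
    + apply Rle_trans with (2 := Rmax_l _ _); now apply HM.
  - destruct (INR_unbounded M) as [n Hn]; destruct (Ht n) as (_ & x & Hx).
    specialize (HM n x); pose proof (norm_nneg x).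
    assert (M * norm x <= (INR n + 1) * norm x) by (apply Rmult_le_compat_r; lra); lra.
Qed.

Lemma sg_bounded b : exists M, 0 < M /\ forall t x, 0 <= t <= b -> norm (Sg t x) <= M * norm x.
Proof.
  destruct sg_bounded_near_zero as (d & M & Hd & HM & Hb).
  assert (K : forall n : nat, exists M', 0 < M' /\
    forall t x, 0 <= t <= INR n * d -> norm (Sg t x) <= M' * norm x).
  { induction n as [|n (M' & HM' & IH)].
    - exists M; split; trivial; intros t x Ht; simpl in Ht; apply Hb; lra.
    - exists (Rmax M (M' * M)); split; [pose proof (Rmax_l M (M' * M)); lra|].
      intros t x Ht; rewrite S_INR in Ht; pose proof (norm_nneg x).
      destruct (Rle_dec t d) as [Htd|Htd].
      + apply Rle_trans with (M * norm x); [apply Hb; lra|].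
        apply Rmult_le_compat_r; [trivial|apply Rmax_l].
      + apply Rle_trans with (M' * M * norm x);
          [|apply Rmult_le_compat_r; [trivial|apply Rmax_r]].
        destruct HS as (_ & _ & Hadd & _).
        replace t with ((t - d) + d) by ring; rewrite Hadd by lra.
        apply Rle_trans with (M' * norm (Sg d x)); [apply IH; lra|].
        rewrite Rmult_assoc; apply Rmult_le_compat_l; [lra|]; apply Hb; lra. }
  destruct (INR_unbounded (b / d)) as [n Hn]; destruct (K n) as (M' & HM' & H).
  exists M'; split; trivial; intros t x Ht; apply H; split; [lra|].
  apply Rle_trans with b; [lra|]; replace b with (b / d * d) by (field; lra).
  apply Rmult_le_compat_r; lra.
Qed.

Lemma sg_ext_nneg t : 0 <= t -> sg_ext Sg t = Sg t.
Proof. intros; unfold sg_ext; now rewrite Rmax_right. Qed.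

Lemma sg_ext_bounded_linear t : bounded_linear (sg_ext Sg t).
Proof. apply sg_bounded_linear, Rmax_l. Qed.

Lemma sg_ext_add s t x : 0 <= s -> 0 <= t ->
  sg_ext Sg (s + t) x = sg_ext Sg s (sg_ext Sg t x).
Proof. intros; rewrite !sg_ext_nneg by lra; now apply HS. Qed.

Lemma sg_ext_zero x : sg_ext Sg 0 x = x.
Proof. rewrite sg_ext_nneg by lra; apply HS. Qed.

(** Factoring out the operator at the earlier time reduces continuity from both sides to right
    continuity at zero. *)
Lemma sg_time_difference b M s t x : (forall t x, 0 <= t <= b -> norm (Sg t x) <= M * norm x) ->
  0 <= s <= b -> 0 <= t <= b ->
  norm (minus (Sg t x) (Sg s x)) <= M * norm (minus (Sg (Rabs (t - s)) x) x).
Proof.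
  intros HM.
  assert (K : forall s t, 0 <= s <= b -> 0 <= t <= b -> s <= t ->
    norm (minus (Sg t x) (Sg s x)) <= M * norm (minus (Sg (Rabs (t - s)) x) x)).
  { intros s' t' Hs Ht Hst; rewrite Rabs_pos_eq by lra.
    destruct HS as (Hlin & _ & Hadd & _).
    replace (Sg t' x) with (Sg s' (Sg (t' - s') x))
      by (rewrite <- Hadd by lra; f_equal; ring).
    rewrite <- (linear_map_minus _ (proj1 (Hlin s' ltac:(lra)))); now apply HM. }
  intros Hs Ht; destruct (Rle_dec s t) as [H|H]; [now apply K|].
  rewrite norm_minus_sym, Rabs_minus_sym; apply K; trivial; lra.
Qed.

Lemma sg_ext_jointly_continuous t0 x0 eps : 0 < eps -> exists del, 0 < del /\
  forall t x, Rabs (t - t0) < del -> norm (minus x x0) < del ->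
    norm (minus (sg_ext Sg t x) (sg_ext Sg t0 x0)) <= eps.
Proof.
  intros He; unfold sg_ext.
  destruct (sg_bounded (Rmax 0 t0 + 1)) as (M & HM & Hb).
  assert (Hp : 0 < eps / (2 * M)) by (apply Rdiv_lt_0_compat; lra).
  destruct (sg_right_continuous x0 _ Hp) as (d & Hd & Hx0).
  set (del := Rmin 1 (Rmin d (eps / (2 * M)))).
  assert (H1 : del <= 1) by apply Rmin_l.
  assert (H2 : del <= d) by (apply Rle_trans with (1 := Rmin_r _ _), Rmin_l).
  assert (H3 : del <= eps / (2 * M)) by (apply Rle_trans with (1 := Rmin_r _ _), Rmin_r).
  exists del; split; [repeat apply Rmin_pos; lra|]; intros t x Ht Hx.
  assert (Hmax : Rabs (Rmax 0 t - Rmax 0 t0) <= Rabs (t - t0)).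
  { unfold Rmax; destruct (Rle_dec 0 t), (Rle_dec 0 t0); split_Rabs; lra. }
  pose proof (Rmax_l 0 t); pose proof (Rmax_l 0 t0).
  assert (Hle : Rmax 0 t <= Rmax 0 t0 + 1) by (split_Rabs; lra).
  replace eps with (M * (eps / (2 * M)) + M * (eps / (2 * M))) by (field; lra).
  apply norm_minus_trans with (Sg (Rmax 0 t) x0).
  - rewrite <- (linear_map_minus _ (proj1 (sg_bounded_linear (Rmax 0 t) ltac:(trivial)))).
    apply Rle_trans with (M * norm (minus x x0)); [apply Hb; lra|].
    apply Rmult_le_compat_l; lra.
  - eapply Rle_trans; [apply (sg_time_difference (Rmax 0 t0 + 1) M); trivial; lra|].
    apply Rmult_le_compat_l; [lra|]; apply Rlt_le, Hx0; split; [apply Rabs_pos|lra].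
Qed.

Lemma sg_ext_continuous (tau : R -> R) (f : R -> X) s :
  continuous tau s -> continuous f s -> continuous (fun r => sg_ext Sg (tau r) (f r)) s.
Proof.
  intros Ht Hf; apply continuous_eps; intros eps He.
  destruct (sg_ext_jointly_continuous (tau s) (f s) (eps / 2) ltac:(lra)) as (d & Hd & H).
  destruct (proj1 (continuous_eps (V := R_NormedModule) tau s) Ht d Hd) as (d1 & Hd1 & H1).
  destruct (proj1 (continuous_eps f s) Hf d Hd) as (d2 & Hd2 & H2).
  exists (Rmin d1 d2); split; [now apply Rmin_pos|]; intros r Hr.
  pose proof (Rmin_l d1 d2); pose proof (Rmin_r d1 d2).
  apply Rle_lt_trans with (eps / 2); [|lra].
  apply H; [apply H1|apply H2]; lra.
Qed.

Lemma duhamel_integrand_continuous t (f : R -> X) :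
  (forall s, continuous f s) -> forall s, continuous (fun r => sg_ext Sg (t - r) (f r)) s.
Proof.
  intros Hf s; apply sg_ext_continuous; [|apply Hf].
  apply (continuous_minus (V := R_NormedModule) (fun _ => t) (fun r => r));
    [apply continuous_const|apply continuous_id].
Qed.

End Semigroup.

(** * Positivity of inhomogeneous evolutions *)

(** The limit defining a generator as an error bound [h * eps], which can be added up, integrated
    and passed to [neg_norm]. *)
Lemma at_right_quotient {V : NormedModule R_AbsRing} (D : R -> V) (l : V) :
  filterlim (fun h => scal (/ h) (D h)) (at_right 0) (locally l) <->
  forall eps, 0 < eps -> exists del, 0 < del /\
    forall h, 0 < h < del -> norm (minus (D h) (scal h l)) <= h * eps.
Proof.
  apply (iff_trans (at_right_eps _ l)); split; intros H eps He.
  - destruct (H eps He) as (d & Hd & Hh); exists d; split; trivial; intros h H1.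
    replace (minus (D h) (scal h l)) with (scal h (minus (scal (/ h) (D h)) l)) by (module; lra).
    apply Rle_trans with (1 := norm_scal_nneg h _ ltac:(lra)), Rmult_le_compat_l; [lra|].
    now apply Rlt_le, Hh.
  - destruct (H (eps / 2) ltac:(lra)) as (d & Hd & Hh); exists d; split; trivial; intros h H1.
    change (norm (minus (scal (/ h) (D h)) l) < eps).
    replace (minus (scal (/ h) (D h)) l) with (scal (/ h) (minus (D h) (scal h l))) by (module; lra).
    assert (Hinv : 0 < / h) by (apply Rinv_0_lt_compat; lra).
    apply Rle_lt_trans with (1 := norm_scal_nneg (/ h) _ ltac:(lra)).
    apply Rle_lt_trans with (/ h * (h * (eps / 2))); [apply Rmult_le_compat_l; [lra|now apply Hh]|].
    rewrite <- Rmult_assoc, Rinv_l; lra.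
Qed.

(** [W] dominates the semigroup evolution up to [o(h)] on each short step. Transporting [W s] to the
    final time by [Sg (c - s)] yields a function whose negative part cannot grow, by positivity and
    local boundedness of [Sg]. *)
Lemma positive_evolution {X : NormedModule R_AbsRing} (HX : sequentially_complete X)
  (Sg : R -> X -> X) (le : X -> X -> Prop) (W : R -> X) c :
  C0_semigroup Sg -> banach_lattice le -> positive_semigroup le Sg ->
  0 <= c -> (forall s, continuous W s) -> le zero (W 0) ->
  (forall s eps, 0 <= s < c -> 0 < eps -> exists del, 0 < del /\ forall h, 0 < h < del ->
     neg_norm le (minus (W (s + h)) (Sg h (W s))) <= h * eps) ->
  le zero (W c).
Proof.
  intros HS HL Hpos Hc HW HW0 Hstep.
  set (phi := fun s => neg_norm le (sg_ext Sg (c - s) (W s))).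
  assert (Hphi : phi c <= phi 0).
  { apply right_growth; trivial.
    - intros s _; apply (continuity_neg_norm le HL), (duhamel_integrand_continuous HX _ HS); trivial.
    - intros s eps Hs He.
      destruct (sg_bounded HX Sg HS c) as (M & HM & Hb).
      destruct (Hstep s (eps / M) Hs ltac:(now apply Rdiv_lt_0_compat)) as (d & Hd & Hh).
      exists (Rmin d (c - s)); split; [apply Rmin_pos; lra|]; intros h H.
      pose proof (Rmin_l d (c - s)); pose proof (Rmin_r d (c - s)).
      specialize (Hh h ltac:(lra)); unfold phi.
      set (D := minus (W (s + h)) (Sg h (W s))) in Hh.
      assert (Hlin : linear_map (sg_ext Sg (c - (s + h)))) by now apply sg_ext_bounded_linear.
      replace (sg_ext Sg (c - (s + h)) (W (s + h)))
        with (plus (sg_ext Sg (c - s) (W s)) (sg_ext Sg (c - (s + h)) D)).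
      + apply Rle_trans with (1 := neg_norm_plus le HL _ _), Rplus_le_compat_l.
        rewrite sg_ext_nneg by lra.
        apply Rle_trans with (M * neg_norm le D).
        * apply (neg_norm_positive_map le HL); [lra|apply sg_bounded_linear; trivial; lra| |].
          { intros x; apply Hb; lra. }
          { intros x Hx; apply Hpos; [lra|trivial]. }
        * replace (h * eps) with (M * (h * (eps / M))) by (field; lra).
          apply Rmult_le_compat_l; lra.
      + unfold D; rewrite (linear_map_minus _ Hlin).
        replace (sg_ext Sg (c - (s + h)) (Sg h (W s))) with (sg_ext Sg (c - s) (W s)); [module|].
        rewrite <- (sg_ext_nneg Sg h), <- sg_ext_add; trivial; try lra; f_equal; ring. }
  apply (nneg_of_neg_norm le HL).
  unfold phi in Hphi; rewrite Rminus_diag, (sg_ext_zero Sg HS), Rminus_0_r in Hphi.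
  rewrite (neg_norm_of_nneg le HL (sg_ext Sg c (W 0))) in Hphi; trivial.
  rewrite sg_ext_nneg by trivial; now apply Hpos.
Qed.

Definition duhamel {X : CompleteNormedModule R_AbsRing} (Sg : R -> X -> X) (x0 : X)
  (g : R -> X) (t : R) : X :=
  plus (sg_ext Sg t x0) (RInt (fun s => sg_ext Sg (t - s) (g s)) 0 t).

Section Duhamel.
Context {X : CompleteNormedModule R_AbsRing} (Sg : R -> X -> X) (HS : C0_semigroup Sg).

Lemma duhamel_continuous_integrand t (g : R -> X) :
  (forall s, continuous g s) -> forall s, continuous (fun r => sg_ext Sg (t - r) (g r)) s.
Proof.
  intros Hg; apply (duhamel_integrand_continuous (complete_sequentially X) Sg HS t g Hg).
Qed.

Lemma duhamel_restart x0 (g : R -> X) s t : (forall s, continuous g s) -> 0 <= s -> 0 <= t ->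
  duhamel Sg x0 g (s + t) = duhamel Sg (duhamel Sg x0 g s) (fun r => g (s + r)) t.
Proof.
  intros Hg Hs Ht; unfold duhamel.
  pose proof (sg_ext_bounded_linear Sg HS t) as Hbl.
  rewrite (proj1 (proj1 Hbl)), <- (sg_ext_add Sg HS) by trivial.
  rewrite (bounded_linear_RInt (sg_ext Sg t)) by (trivial; now apply duhamel_continuous_integrand).
  rewrite (RInt_ext (fun r => sg_ext Sg t (sg_ext Sg (s - r) (g r)))
                    (fun r => sg_ext Sg (s + t - r) (g r))).
  2: { intros r; rewrite Rmin_left, Rmax_right by trivial; intros Hr.
       rewrite <- (sg_ext_add Sg HS) by lra; f_equal; ring. }
  rewrite (RInt_ext (fun r => sg_ext Sg (t - r) (g (s + r)))
                    (fun r => sg_ext Sg (s + t - (s + r)) (g (s + r)))).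
  2: { intros r _; f_equal; ring. }
  rewrite (RInt_shift (fun r => sg_ext Sg (s + t - r) (g r)))
    by now apply duhamel_continuous_integrand.
  rewrite <- (RInt_Chasles _ 0 s (s + t)) by (apply ex_RInt_cont; now apply duhamel_continuous_integrand).
  rewrite Rplus_0_r, (Rplus_comm t s); module.
Qed.

Lemma duhamel_zero x0 (g : R -> X) : duhamel Sg x0 g 0 = x0.
Proof. unfold duhamel; rewrite RInt_point, (sg_ext_zero Sg HS); module. Qed.

(** One [del] serves all [s] in [[0, t]], because this error is later integrated over [s]. *)
Lemma duhamel_local_error (g : R -> X) t eps : (forall s, continuous g s) -> 0 < eps ->
  exists del, 0 < del /\ forall h s, 0 < h < del -> 0 <= s <= t ->
    norm (minus (RInt (fun r => sg_ext Sg (h - r) (g (s + r))) 0 h) (scal h (g s))) <= h * eps.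
Proof.
  intros Hg He.
  destruct (uniform_near_diagonal (fun p q => sg_ext Sg p (g q)) g 0 t) with (3 := He)
    as (d & Hd & H); trivial.
  { intros q0 e He0.
    destruct (sg_ext_jointly_continuous (complete_sequentially X) Sg HS 0 (g q0) e He0)
      as (d & Hd & H).
    destruct (proj1 (continuous_eps g q0) (Hg q0) d Hd) as (d' & Hd' & H').
    rewrite (sg_ext_zero Sg HS) in H.
    exists (Rmin d d'); split; [now apply Rmin_pos|]; intros p q Hp Hq.
    pose proof (Rmin_l d d'); pose proof (Rmin_r d d').
    apply H; [rewrite Rminus_0_r; lra|apply H'; lra]. }
  exists d; split; trivial; intros h s Hh Hs.
  replace (scal h (g s)) with (scal (h - 0) (g s)) by (f_equal; ring).
  replace (h * eps) with ((h - 0) * eps) by ring.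
  apply (RInt_near (fun r => sg_ext Sg (h - r) (g (s + r)))); [lra| |].
  - apply duhamel_continuous_integrand with (g := fun r => g (s + r)); apply (continuous_shift g s Hg).
  - intros r Hr; apply H; trivial; apply Rabs_def1; lra.
Qed.

(* Integrate v(s + h) = S(h) v(s) + int_0^h S(h - r) g(s + r) dr over s in [0, t]. *)
Lemma duhamel_primitive_generator x0 (g v : R -> X) b t :
  (forall s, continuous g s) -> (forall s, continuous v s) ->
  (forall s, 0 <= s < b -> v s = duhamel Sg x0 g s) -> 0 <= t < b ->
  filterlim (fun h => scal (/ h) (minus (Sg h (RInt v 0 t)) (RInt v 0 t))) (at_right 0)
    (locally (minus (minus (v t) x0) (RInt g 0 t))).
Proof.
  intros Hg Hv Hmild Ht.
  apply (at_right_quotient (fun h => minus (Sg h (RInt v 0 t)) (RInt v 0 t))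
    (minus (minus (v t) x0) (RInt g 0 t))); intros eps He.
  (* Two endpoint errors of size [h * e] and an integrated one of size [t * h * e] add up to
     [h * eps]. *)
  set (e := eps / (t + 2)).
  assert (He0 : 0 < e) by (apply Rdiv_lt_0_compat; lra).
  destruct (duhamel_local_error g t e Hg He0) as (d1 & Hd1 & H1).
  destruct (RInt_right_derivative v 0 t e Hv He0) as (d2 & Hd2 & H2).
  destruct (RInt_right_derivative v 0 0 e Hv He0) as (d3 & Hd3 & H3).
  (* The entry [b - t] keeps [s + h] below [b], where the Duhamel formula for [v] holds. *)
  set (d := Rmin (Rmin d1 (b - t)) (Rmin d2 d3)).
  assert (Hda : d <= d1) by (apply Rle_trans with (1 := Rmin_l _ _), Rmin_l).
  assert (Hdb : d <= b - t) by (apply Rle_trans with (1 := Rmin_l _ _), Rmin_r).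
  assert (Hdc : d <= d2) by (apply Rle_trans with (1 := Rmin_r _ _), Rmin_l).
  assert (Hdd : d <= d3) by (apply Rle_trans with (1 := Rmin_r _ _), Rmin_r).
  exists d; split; [repeat apply Rmin_pos; lra|]; intros h Hh.
  specialize (H2 h ltac:(lra)); specialize (H3 h ltac:(lra)).
  rewrite RInt_point, Rplus_0_l in H3.
  assert (Hv0 : v 0 = x0) by (rewrite Hmild by lra; apply duhamel_zero).
  rewrite Hv0 in H3.
  pose proof (sg_bounded_linear Sg HS h ltac:(lra)) as HUh.
  set (D := fun s => minus (minus (v (h + s)) (Sg h (v s))) (scal h (g s))).
  assert (HvS : forall s, continuous (fun s => v (h + s)) s) by apply (continuous_shift v h Hv).
  assert (HSv : forall s, continuous (fun s => Sg h (v s)) s).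
  { intros s; apply (bounded_linear_continuous (Sg h) v s HUh), Hv. }
  assert (Hgs : forall s, continuous (fun s => scal h (g s)) s).
  { intros s; apply (continuous_scal_r h g), Hg. }
  assert (HvSv : forall s, continuous (fun s => minus (v (h + s)) (Sg h (v s))) s).
  { intros s; apply (continuous_minus (fun s => v (h + s)) (fun s => Sg h (v s))); auto. }
  assert (HDc : forall s, continuous D s).
  { intros s; apply (continuous_minus (fun s => minus (v (h + s)) (Sg h (v s)))); auto. }
  assert (HDb : norm (RInt D 0 t) <= (t - 0) * (h * e)).
  { apply RInt_norm_le; trivial; [lra|]; intros s Hs.
    unfold D; replace (minus (v (h + s)) (Sg h (v s)))
      with (RInt (fun r => sg_ext Sg (h - r) (g (s + r))) 0 h); [apply H1; lra|].
    rewrite (Rplus_comm h s), Hmild, duhamel_restart, <- Hmild by (trivial; lra).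
    unfold duhamel; rewrite sg_ext_nneg by lra; module. }
  assert (HDe : RInt D 0 t = minus (minus (minus (RInt v 0 (t + h)) (RInt v 0 h))
     (Sg h (RInt v 0 t))) (scal h (RInt g 0 t))).
  { unfold D; rewrite (RInt_minus (fun s => minus (v (h + s)) (Sg h (v s)))) by now apply ex_RInt_cont.
    rewrite (RInt_minus (fun s => v (h + s))), RInt_scal by now apply ex_RInt_cont.
    rewrite RInt_shift, RInt_between, (bounded_linear_RInt (Sg h)) by trivial.
    rewrite Rplus_0_r, (Rplus_comm h t); trivial. }
  change (norm (minus (minus (Sg h (RInt v 0 t)) (RInt v 0 t))
    (scal h (minus (minus (v t) x0) (RInt g 0 t)))) <= h * eps).
  (* The shift by [h] leaves only the end pieces of the integral of [v] over [[t, t + h]] and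
     [[0, h]], which produce [h v(t)] and [h x0]. *)
  replace (minus (minus (Sg h (RInt v 0 t)) (RInt v 0 t))
      (scal h (minus (minus (v t) x0) (RInt g 0 t))))
    with (minus (minus (minus (minus (RInt v 0 (t + h)) (RInt v 0 t)) (scal h (v t)))
       (minus (minus (RInt v 0 h) zero) (scal h x0))) (RInt D 0 t)) by (rewrite HDe; module).
  replace (h * eps) with (h * e + h * e + (t - 0) * (h * e)) by (unfold e; field; lra).
  apply (norm_le_minus (V := X)); trivial; now apply (norm_le_minus (V := X)).
Qed.

End Duhamel.

(* With A the generator of Sg and Z the primitive of v, the increments W(s) = Z(s + k) - Z(s)
   satisfy W' = A W + (non-negative forcing), so Z is increasing and v = Z' is non-negative. *)
Lemma primitive_increasing_nneg {X : CompleteNormedModule R_AbsRing} (le : X -> X -> Prop)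
  (Sg : R -> X -> X) (x0 : X) (v d : R -> X) b :
  banach_lattice le -> C0_semigroup Sg -> positive_semigroup le Sg ->
  (forall s, continuous v s) -> (forall s, continuous d s) ->
  le zero x0 -> (forall s, 0 <= s < b -> le zero (d s)) ->
  (forall t, 0 <= t < b ->
     filterlim (fun h => scal (/ h) (minus (Sg h (RInt v 0 t)) (RInt v 0 t))) (at_right 0)
       (locally (minus (v t) (plus x0 (RInt d 0 t))))) ->
  forall t, 0 <= t < b -> le zero (v t).
Proof.
  intros HL HS Hpos Hv Hd Hx0 Hd0 Hgen.
  set (Z := fun t => RInt v 0 t).
  set (p := fun t => plus x0 (RInt d 0 t)).
  assert (HZ0 : Z 0 = zero) by (unfold Z; now rewrite RInt_point).
  assert (HZc : forall s, continuous Z s) by (intros; now apply continuous_RInt_upper).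
  assert (Hstep : forall t eps, 0 <= t < b -> 0 < eps -> exists del, 0 < del /\
     forall h, 0 < h < del ->
       norm (minus (minus (Z (t + h)) (Sg h (Z t))) (scal h (p t))) <= h * eps).
  { intros t eps Ht He.
    destruct (RInt_right_derivative v 0 t (eps / 2) Hv ltac:(lra)) as (d1 & Hd1 & H1).
    destruct (proj1 (at_right_quotient (fun h => minus (Sg h (Z t)) (Z t)) _) (Hgen t Ht)
      (eps / 2) ltac:(lra)) as (d2 & Hd2 & H2).
    exists (Rmin d1 d2); split; [now apply Rmin_pos|]; intros h Hh.
    pose proof (Rmin_l d1 d2); pose proof (Rmin_r d1 d2).
    specialize (H1 h ltac:(lra)); specialize (H2 h ltac:(lra)).
    replace (minus (minus (Z (t + h)) (Sg h (Z t))) (scal h (p t)))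
      with (minus (minus (minus (Z (t + h)) (Z t)) (scal h (v t)))
        (minus (minus (Sg h (Z t)) (Z t)) (scal h (minus (v t) (p t))))) by module.
    replace (h * eps) with (h * (eps / 2) + h * (eps / 2)) by field.
    now apply (norm_le_minus (V := X)). }
  assert (Hneg : forall x y z e, le zero y -> norm (minus x y) <= e -> z = x -> neg_norm le z <= e).
  { intros x y z e Hy Hxy ->.
    replace x with (plus y (minus x y)) by module.
    apply Rle_trans with (1 := neg_norm_plus le HL _ _).
    rewrite (neg_norm_of_nneg le HL y Hy).
    pose proof (neg_norm_le_norm le HL (minus x y)).
    apply Rle_trans with (2 := Hxy); lra. }
  (* Needed as initial value: the increment with step [k] starts at [Z k]. *)
  assert (HZ : forall k, 0 <= k < b -> le zero (Z k)).
  { intros k Hk.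
    apply (positive_evolution (complete_sequentially X) Sg le Z k HS HL Hpos); trivial; try lra.
    - rewrite HZ0; apply (le_refl le HL).
    - intros s eps Hs He; destruct (Hstep s eps ltac:(lra) He) as (del & Hdel & H).
      exists del; split; trivial; intros h Hh.
      apply (Hneg _ (scal h (p s)) _ _) with (2 := H h Hh); trivial.
      apply (nneg_scal le HL); [lra|]; apply (nneg_plus le HL); trivial.
      apply (nneg_RInt le); trivial; [lra|]; intros r Hr; apply Hd0; lra. }
  assert (HW : forall c k, 0 <= c -> 0 < k -> c + k < b -> le zero (minus (Z (k + c)) (Z c))).
  { intros c k Hc Hk Hck.
    apply (positive_evolution (complete_sequentially X) Sg le
      (fun s => minus (Z (k + s)) (Z s)) c HS HL Hpos); trivial.
    - intros s; apply (continuous_minus (V := X)); [apply (continuous_shift Z k HZc)|apply HZc].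
    - assert (HW0 : Z k = minus (Z (k + 0)) (Z 0)) by (rewrite HZ0, Rplus_0_r; module).
      pose proof (HZ k ltac:(lra)) as HZk; rewrite HW0 in HZk; exact HZk.
    - intros s eps Hs He.
      destruct (Hstep s (eps / 2) ltac:(lra) ltac:(lra)) as (d1 & Hd1 & H1).
      destruct (Hstep (k + s) (eps / 2) ltac:(lra) ltac:(lra)) as (d2 & Hd2 & H2).
      exists (Rmin d1 d2); split; [now apply Rmin_pos|]; intros h Hh.
      pose proof (Rmin_l d1 d2); pose proof (Rmin_r d1 d2).
      specialize (H1 h ltac:(lra)); specialize (H2 h ltac:(lra)).
      (* The forcing of the increment is [p (k + s) - p s], an integral of [d]. *)
      apply (Hneg (minus (minus (Z (k + s + h)) (Sg h (Z (k + s)))) (minus (Z (s + h)) (Sg h (Z s))))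
        (scal h (minus (p (k + s)) (p s)))).
      + apply (nneg_scal le HL); [lra|].
        replace (minus (p (k + s)) (p s)) with (RInt d s (k + s)).
        * apply (nneg_RInt le); trivial; [lra|]; intros r Hr; apply Hd0; lra.
        * rewrite <- (RInt_between d 0) by trivial; unfold p; module.
      + replace (h * eps) with (h * (eps / 2) + h * (eps / 2)) by field.
        replace (minus (minus (minus (Z (k + s + h)) (Sg h (Z (k + s)))) (minus (Z (s + h)) (Sg h (Z s))))
            (scal h (minus (p (k + s)) (p s))))
          with (minus (minus (minus (Z (k + s + h)) (Sg h (Z (k + s)))) (scal h (p (k + s))))
            (minus (minus (Z (s + h)) (Sg h (Z s))) (scal h (p s)))) by module.
        now apply (norm_le_minus (V := X)).
      + rewrite (linear_map_minus (Sg h)) by (apply HS; lra).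
        replace (k + (s + h)) with (k + s + h) by ring; module. }
  intros t Ht; apply (nneg_closed le HL); intros eps He.
  destruct (RInt_right_derivative v 0 t eps Hv He) as (d1 & Hd1 & H1).
  set (k := Rmin (d1 / 2) ((b - t) / 2)).
  assert (Hk : 0 < k) by (apply Rmin_pos; lra).
  assert (Hkd : k < d1) by (apply Rle_lt_trans with (1 := Rmin_l _ _); lra).
  assert (Hkb : k < b - t) by (apply Rle_lt_trans with (1 := Rmin_r _ _); lra).
  specialize (H1 k ltac:(lra)).
  assert (Hinv : 0 < / k) by now apply Rinv_0_lt_compat.
  exists (scal (/ k) (minus (Z (k + t)) (Z t))); split.
  - apply (nneg_scal le HL); [lra|]; apply HW; lra.
  - rewrite (Rplus_comm k t).
    assert (E : minus (v t) (scal (/ k) (minus (Z (t + k)) (Z t)))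
      = scal (/ k) (opp (minus (minus (Z (t + k)) (Z t)) (scal k (v t))))) by (module; lra).
    apply Rle_trans with (1 := Req_le _ _ (f_equal norm E)).
    apply Rle_trans with (1 := norm_scal_nneg (V := X) (/ k) _ ltac:(lra)).
    apply Rle_trans with (/ k * (k * eps)).
    + apply Rmult_le_compat_l; [lra|]; apply Rle_trans with (2 := H1).
      right; apply (norm_opp (V := X)).
    + rewrite <- Rmult_assoc, Rinv_l; lra.
Qed.

(** [G] and [G - gam H] have the same domain, so the primitive of [J z] belongs to both. There the
    integral of [gam H z] equals [gam H] of the integral of [z] and cancels against the
    perturbation, leaving the forcing [d] alone. *)
Lemma duhamel_nneg {X Y : CompleteNormedModule R_AbsRing} (J H : Y -> X)
  (leX : X -> X -> Prop) (S Sg : R -> X -> X) (DG : X -> Prop) (G : X -> X) (gam : R)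
  (x0 : X) (z : R -> Y) (d : R -> X) b :
  bounded_linear J -> bounded_linear H -> banach_lattice leX ->
  C0_semigroup S -> generator S (fun x l => DG x /\ l = G x) ->
  C0_semigroup Sg ->
  generator Sg (fun x l => DG x /\ exists y, J y = x /\ l = minus (G x) (scal gam (H y))) ->
  positive_semigroup leX Sg ->
  (forall s, continuous z s) -> (forall s, continuous d s) ->
  leX zero x0 -> (forall s, 0 <= s < b -> leX zero (d s)) ->
  (forall t, 0 <= t < b ->
     J (z t) = duhamel S x0 (fun s => minus (d s) (scal gam (H (z s)))) t) ->
  forall t, 0 <= t < b -> leX zero (J (z t)).
Proof.
  intros HJ HH HL HS HG HSg HGg Hpos Hz Hd Hx0 Hd0 Hmild.
  set (v := fun t => J (z t)); set (g := fun s => minus (d s) (scal gam (H (z s)))).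
  assert (Hv : forall s, continuous v s).
  { intros s; apply (bounded_linear_continuous J z s HJ), Hz. }
  assert (HHz : forall s, continuous (fun s => H (z s)) s).
  { intros s; apply (bounded_linear_continuous H z s HH), Hz. }
  assert (HgHz : forall s, continuous (fun s => scal gam (H (z s))) s).
  { intros s; apply (continuous_scal_r gam (fun s => H (z s))), HHz. }
  assert (Hg : forall s, continuous g s).
  { intros s; apply (continuous_minus d); auto. }
  apply (primitive_increasing_nneg leX Sg x0 v d b); trivial; intros t Ht.
  pose proof (duhamel_primitive_generator S HS x0 g v b t Hg Hv Hmild Ht) as Hlim.
  apply HG in Hlim; destruct Hlim as [HDG HGZ].
  apply HGg; split; trivial; exists (RInt z 0 t); split.
  - apply (bounded_linear_RInt J z 0 t HJ Hz).
  - assert (Hgint : RInt g 0 t = minus (RInt d 0 t) (scal gam (H (RInt z 0 t)))).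
    { etransitivity; [apply (RInt_minus d (fun s => scal gam (H (z s)))); now apply ex_RInt_cont|].
      rewrite RInt_scal by now apply ex_RInt_cont.
      now rewrite (bounded_linear_RInt H z 0 t HH Hz). }
    rewrite <- HGZ, Hgint; module.
Qed.

(** * Invariance of the cone on short intervals *)

Section Step.
Context {X Y : CompleteNormedModule R_AbsRing} (J H : Y -> X) (leX : X -> X -> Prop).
Context (S : R -> X -> X) (eta : R -> R).
Context (HJ : bounded_linear J) (HJinj : forall y1 y2, J y1 = J y2 -> y1 = y2).
Context (HS : C0_semigroup S).
Context (Hb : forall (s0 s1 : R) (phi : R -> X), 0 <= s0 -> s0 < s1 ->
  (forall s, s0 <= s <= s1 ->
     filterlim phi (within (fun r => s0 <= r <= s1) (locally s)) (locally (phi s))) ->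
  exists y : Y,
    J y = RInt (fun s => S (s1 - s) (phi s)) s0 s1 /\
    (forall M : R, (forall s, s0 <= s <= s1 -> norm (phi s) <= M) ->
       norm y <= eta (s1 - s0) * M)).

(* The smoothing operator is applied on the fixed window [0, del] to translates of phi,
   so that continuity of w does not need any bound on eta near other points. *)
Lemma smoothing_path (del : R) (phi : R -> X) : 0 < del -> 0 < eta del ->
  (forall s, continuous phi s) ->
  exists w : R -> Y, (forall t, continuous w t) /\
    (forall t, J (w t) = RInt (fun s => sg_ext S (del - s) (phi (t - del + s))) 0 del) /\
    (forall t M, (forall s, t - del <= s <= t -> norm (phi s) <= M) -> norm (w t) <= eta del * M).
Proof.
  intros Hdel Heta Hphi.
  assert (Hex : forall psi : R -> X, (forall s, continuous psi s) -> exists y : Y,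
    J y = RInt (fun s => sg_ext S (del - s) (psi s)) 0 del /\
    forall M, (forall s, 0 <= s <= del -> norm (psi s) <= M) -> norm y <= eta del * M).
  { intros psi Hpsi; destruct (Hb 0 del psi ltac:(lra) Hdel) as (y & Hy1 & Hy2).
    - intros s _ P HP; specialize (Hpsi s P HP); revert Hpsi.
      unfold filtermap, within; apply filter_imp; auto.
    - exists y; rewrite Rminus_0_r in Hy2; split; trivial.
      rewrite Hy1; apply RInt_ext; intros s; rewrite Rmin_left, Rmax_right by lra; intros Hs.
      now rewrite sg_ext_nneg by lra. }
  assert (Hsh : forall t s, continuous (fun s => phi (t - del + s)) s).
  { intros t; apply (continuous_shift phi (t - del) Hphi). }
  destruct (choice _ (fun t => Hex _ (Hsh t))) as [w Hw].
  exists w; split; [|split].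
  - intros t0; apply (continuous_eps w t0); intros eps He.
    set (e := eps / (2 * eta del)).
    assert (He0 : 0 < e) by (apply Rdiv_lt_0_compat; lra).
    (* With a dummy first argument this is uniform continuity of [phi] near the window. *)
    destruct (uniform_near_diagonal (fun _ q => phi q) phi (t0 - del) t0) with (3 := He0)
      as (d & Hd & Hu); trivial.
    { intros q0 e' He'; destruct (proj1 (continuous_eps phi q0) (Hphi q0) e' He') as (d & Hd & Hh).
      exists d; split; trivial; intros _ q _ Hq; now apply Rlt_le, Hh. }
    exists d; split; trivial; intros t Ht.
    destruct (Hex (fun s => minus (phi (t - del + s)) (phi (t0 - del + s)))) as (y & Hy1 & Hy2).
    { intros s; apply (continuous_minus (fun s => phi (t - del + s))); apply Hsh. }
    (* Linearity holds in [X] and is pulled back by injectivity of [J], so (b) applies to the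
       difference of two translates. *)
    assert (Ey : minus (w t) (w t0) = y).
    { apply HJinj; rewrite Hy1, (linear_map_minus J (proj1 HJ)).
      rewrite (proj1 (Hw t)), (proj1 (Hw t0)).
      etransitivity; [symmetry; apply (RInt_minus (fun s => sg_ext S (del - s) (phi (t - del + s))));
        apply ex_RInt_cont, (duhamel_continuous_integrand S HS del); apply Hsh|].
      apply RInt_ext; intros s _; symmetry.
      apply (linear_map_minus (sg_ext S (del - s))), sg_ext_bounded_linear, HS. }
    apply Rle_lt_trans with (1 := Req_le _ _ (f_equal norm Ey)).
    apply Rle_lt_trans with (eta del * e).
    + apply Hy2; intros s Hs.
      apply (Hu (t0 - del + s) 0); [lra|rewrite Rabs_R0; lra|].
      replace (t - del + s - (t0 - del + s)) with (t - t0) by ring; trivial.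
    + unfold e; replace (eta del * (eps / (2 * eta del))) with (eps / 2) by (field; lra); lra.
  - intros t; apply Hw.
  - intros t M HM; apply Hw; intros s Hs; apply HM; lra.
Qed.

(** The window [[t - del, t]] sees [phi] only on [[0, t]], so the integral of fixed length is the
    Duhamel integral. *)
Lemma window_duhamel del (phi : R -> X) t : (forall s, continuous phi s) ->
  (forall s, s <= 0 -> phi s = zero) -> 0 <= t <= del ->
  RInt (fun s => sg_ext S (del - s) (phi (t - del + s))) 0 del = duhamel S zero phi t.
Proof.
  intros Hphi H0 Ht; unfold duhamel.
  pose proof (duhamel_continuous_integrand S HS t phi Hphi) as Hc.
  rewrite (RInt_ext _ (fun s => sg_ext S (t - (t - del + s)) (phi (t - del + s))))
    by (intros s _; f_equal; ring).
  rewrite (RInt_shift (fun r => sg_ext S (t - r) (phi r)) (t - del) 0 del) by trivial.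
  rewrite <- (RInt_Chasles _ _ 0) by now apply ex_RInt_cont.
  f_equal; [|f_equal; ring].
  transitivity (zero : X);
    [|symmetry; apply (linear_map_zero (sg_ext S t)); now apply sg_ext_bounded_linear].
  rewrite (RInt_ext _ (fun _ => zero)).
  - rewrite RInt_const; module.
  - intros s Hs; rewrite Rmax_right in Hs by lra; rewrite H0 by lra.
    apply (linear_map_zero (sg_ext S (t - s))); now apply sg_ext_bounded_linear.
Qed.

Lemma duhamel_plus x1 x2 (g1 g2 : R -> X) t :
  (forall s, continuous g1 s) -> (forall s, continuous g2 s) ->
  duhamel S (plus x1 x2) (fun s => plus (g1 s) (g2 s)) t
  = plus (duhamel S x1 g1 t) (duhamel S x2 g2 t).
Proof.
  intros H1 H2; unfold duhamel.
  rewrite (proj1 (proj1 (sg_ext_bounded_linear S HS t))).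
  replace (RInt (fun s => sg_ext S (t - s) (plus (g1 s) (g2 s))) 0 t)
    with (plus (RInt (fun s => sg_ext S (t - s) (g1 s)) 0 t)
               (RInt (fun s => sg_ext S (t - s) (g2 s)) 0 t)).
  - module.
  - rewrite <- RInt_plus by now apply ex_RInt_cont, duhamel_continuous_integrand.
    apply RInt_ext; intros s _; symmetry; apply (sg_ext_bounded_linear S HS (t - s)).
Qed.

Context (DG : X -> Prop) (G : X -> X).
Context (HG : generator S (fun x l => DG x /\ l = G x)).
Context (HX : banach_lattice leX).
Context (HY : banach_lattice (fun y1 y2 : Y => leX (J y1) (J y2))).
Context (HHbl : bounded_linear H) (HHpos : forall y, leX zero (J y) -> leX zero (H y)).
Context (HSgam : forall gam : R, 0 <= gam ->
  exists Sg : R -> X -> X,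
    C0_semigroup Sg /\
    generator Sg (fun x l => DG x /\ exists y, J y = x /\ l = minus (G x) (scal gam (H y))) /\
    positive_semigroup leX Sg).

Local Notation leY := (fun y1 y2 : Y => leX (J y1) (J y2)).

(* With e the error made by replacing u by its positive part and w the smoothed |e|,
   both w and u + w are mild solutions with non-negative forcing. *)
Lemma nneg_step (uc : R -> Y) (f fp : R -> X) (gam L KH del b : R) :
  0 <= gam -> 0 <= L -> 0 <= KH -> 0 < del -> 0 < eta del -> b <= del ->
  (forall y, norm (H y) <= KH * norm y) ->
  eta del * (L + gam * KH) <= / 2 ->
  (forall s, continuous uc s) -> (forall s, continuous f s) -> (forall s, continuous fp s) ->
  (forall s, s <= 0 -> leX zero (J (uc s))) ->
  (forall s, norm (minus (f s) (fp s)) <= L * norm (minus (uc s) (pos_part leY (uc s)))) ->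
  (forall s, leX zero (plus (fp s) (scal gam (H (pos_part leY (uc s)))))) ->
  (forall t, 0 <= t < b -> J (uc t) = duhamel S (J (uc 0)) f t) ->
  forall t, 0 <= t < b -> leX zero (J (uc t)).
Proof.
  intros Hgam HL HKH Hdel Heta Hbd HHb Hsmall Huc Hf Hfp Hneg Hlip Hpos Hmild.
  assert (Hle0 : forall y, leX zero (J y) <-> leX (J zero) (J y)).
  { intros y; assert (E : J zero = zero) by exact (linear_map_zero J (proj1 HJ)).
    now rewrite E. }
  set (up := fun s => pos_part leY (uc s)).
  set (n := fun s => neg_norm leY (uc s)).
  (* Chosen so that [f = (fp + gam H up) + e - gam H uc], the shape that [duhamel_nneg] expects. *)
  set (e := fun s => plus (minus (f s) (fp s)) (scal gam (H (minus (uc s) (up s))))).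
  set (phi := fun s => labs leX (e s)).
  assert (Hn : forall s, norm (minus (uc s) (up s)) = n s).
  { intros s; unfold n, neg_norm, up.
    exact (eq_trans (f_equal norm (minus_pos_part leY HY (uc s))) (norm_opp (V := Y) _)). }
  assert (Hnn : forall s, 0 <= n s) by (intros; apply neg_norm_nneg).
  assert (He : forall s, norm (e s) <= (L + gam * KH) * n s).
  { intros s; rewrite Rmult_plus_distr_r; apply (norm_le_plus (V := X)).
    - rewrite <- Hn; apply Hlip.
    - apply Rle_trans with (1 := norm_scal_nneg (V := X) gam _ Hgam).
      rewrite Rmult_assoc; apply Rmult_le_compat_l; trivial; rewrite <- Hn; apply HHb. }
  assert (Hup : forall s, continuous up s).
  { intros s; apply (continuous_pos_part_comp leY HY uc s), Huc. }
  assert (HHc : forall y : R -> Y, (forall s, continuous y s) ->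
    forall s, continuous (fun s => scal gam (H (y s))) s).
  { intros y Hy s; apply (continuous_scal_r gam (fun s => H (y s))).
    apply (bounded_linear_continuous H y s HHbl), Hy. }
  assert (Hec : forall s, continuous e s).
  { intros s; apply (continuous_plus (fun s => minus (f s) (fp s))).
    - apply (continuous_minus f fp); auto.
    - apply (HHc (fun s => minus (uc s) (up s))); intros r; apply (continuous_minus uc up); auto. }
  assert (Hphic : forall s, continuous phi s).
  { intros s; apply (continuous_labs_comp leX HX e s), Hec. }
  assert (Hphi0 : forall s, leX zero (phi s)) by (intros; apply (labs_nneg leX HX)).
  assert (Hphin : forall s, norm (phi s) <= (L + gam * KH) * n s).
  { intros s; apply Rle_trans with (2 := He s), (norm_labs_le leX HX). }
  assert (Hn0 : forall s, s <= 0 -> n s = 0).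
  { intros s Hs; apply (neg_norm_of_nneg leY HY), Hle0; auto. }
  assert (Hphiz : forall s, s <= 0 -> phi s = zero).
  { intros s Hs; apply norm_eq_zero; specialize (Hphin s); rewrite Hn0 in Hphin by trivial.
    pose proof (norm_nneg (V := X) (phi s)); apply Rle_antisym; lra. }
  destruct (smoothing_path del phi Hdel Heta Hphic) as (w & Hwc & HwJ & Hwn).
  assert (Hwd : forall t, 0 <= t <= del -> J (w t) = duhamel S zero phi t).
  { intros t Ht; rewrite HwJ; now apply window_duhamel. }
  assert (Hw0 : forall t, 0 <= t < del -> leX zero (J (w t))).
  { destruct (HSgam 0 (Rle_refl 0)) as (S0 & HS0 & HG0 & Hpos0).
    apply (duhamel_nneg J H leX S S0 DG G 0 zero w phi); trivial.
    - apply (le_refl leX HX).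
    - intros t Ht; rewrite Hwd by lra; f_equal.
      apply functional_extensionality; intros s; module. }
  assert (Hz : forall t, 0 <= t < b -> leX zero (J (plus (uc t) (w t)))).
  { destruct (HSgam gam Hgam) as (Sg & HSg & HGg & Hposg).
    (* Three non-negative terms: the first by (f), the second because [phi = |e|], and the last,
       [gam H w], offsets the part of [- gam H (uc + w)] due to [w]. *)
    set (d := fun s => plus (plus (plus (fp s) (scal gam (H (up s)))) (plus (e s) (phi s)))
                            (scal gam (H (w s)))).
    apply (duhamel_nneg J H leX S Sg DG G gam (J (uc 0)) (fun t => plus (uc t) (w t)) d); trivial.
    - intros s; apply (continuous_plus uc w); auto.
    - intros s; apply (continuous_plus (fun s => plus (plus (fp s) (scal gam (H (up s)))) (plus (e s) (phi s)))).
      + apply (continuous_plus (fun s => plus (fp s) (scal gam (H (up s))))).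
        * apply (continuous_plus fp); auto; now apply HHc.
        * apply (continuous_plus e); auto.
      + now apply HHc.
    - apply Hneg; lra.
    - intros s Hs; apply (nneg_plus leX HX); [apply (nneg_plus leX HX)|].
      + apply Hpos.
      + apply (le_opp leX HX), (le_opp_labs leX HX).
      + apply (nneg_scal leX HX); trivial; apply HHpos, Hw0; lra.
    - intros t Ht; rewrite (proj1 (proj1 HJ)), Hmild, Hwd by lra.
      rewrite <- duhamel_plus by trivial; f_equal; [module|].
      apply functional_extensionality; intros s; unfold d, e.
      rewrite (linear_map_minus H (proj1 HHbl)), (proj1 (proj1 HHbl)); module. }
  assert (Hnw : forall t, 0 <= t < b -> n t <= norm (w t)).
  { intros t Ht; apply (norm_le_of_nneg leY HY); [apply (pos_part_nneg leY HY)|].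
    apply (pos_part_least leY HY).
    - apply (le_opp leY HY), Hle0, Hz, Ht.
    - apply Hle0, Hw0; lra. }
  intros c Hc; apply Hle0, (nneg_of_neg_norm leY HY); change (n c <= 0).
  (* At a maximum point [x] of [n] on [[0, c]] the window before [x] sees only values up to [n x],
     so [n x <= n x / 2]. *)
  destruct (continuity_ab_maj n 0 c (proj1 Hc)) as (x & Hmax & Hx).
  { intros s _; apply (continuity_neg_norm leY HY), Huc. }
  specialize (Hmax c ltac:(lra)) as Hcx.
  assert (Hxw : norm (w x) <= eta del * ((L + gam * KH) * n x)).
  { apply Hwn; intros s Hs; apply Rle_trans with (1 := Hphin s).
    assert (0 <= gam * KH) by now apply Rmult_le_pos.
    apply Rmult_le_compat_l; [lra|].
    destruct (Rle_dec s 0) as [Hs0|Hs0]; [rewrite Hn0; trivial|apply Hmax; lra]. }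
  pose proof (Hnw x ltac:(lra)) as Hnx.
  assert (eta del * (L + gam * KH) * n x <= / 2 * n x) by now apply Rmult_le_compat_r.
  pose proof (Hnn x); lra.
Qed.

End Step.

(** * Positivity of the mild solution *)

(** Composition with [clamp] extends functions on [[0, b]] continuously to the whole line and keeps
    times in the interval where the constants are valid. *)
Definition clamp (b s : R) : R := Rmin b (Rmax 0 s).

Lemma clamp_bounds b s : 0 <= b -> 0 <= clamp b s <= b.
Proof.
  intros; unfold clamp; split; [apply Rmin_glb; [trivial|apply Rmax_l]|apply Rmin_l].
Qed.

Lemma clamp_id b s : 0 <= s <= b -> clamp b s = s.
Proof. intros; unfold clamp; rewrite Rmax_right, Rmin_right; lra. Qed.

Lemma continuous_clamp b s : continuous (clamp b) s.
Proof.
  apply (continuous_eps (V := R_NormedModule)); intros eps He; exists eps; split; trivial.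
  intros t Ht; change (Rabs (clamp b t - clamp b s) < eps); revert Ht.
  unfold clamp, Rmin, Rmax; destruct (Rle_dec 0 t), (Rle_dec 0 s);
    repeat destruct Rle_dec; split_Rabs; lra.
Qed.

Lemma continuous_time_dependent {X Y : NormedModule R_AbsRing} (F : R -> Y -> X) (D : R -> Prop) :
  (forall t y, D t -> filterlim (fun p : R * Y => F (fst p) (snd p))
     (within (fun p : R * Y => D (fst p)) (locally (t, y))) (locally (F t y))) ->
  forall (tau : R -> R) (y : R -> Y) s, (forall s, D (tau s)) ->
    continuous tau s -> continuous y s -> continuous (fun s => F (tau s) (y s)) s.
Proof.
  intros HF tau y s HD Ht Hy.
  apply filterlim_comp with (f := fun s => (tau s, y s)) (g := fun p : R * Y => F (fst p) (snd p))
    (2 := HF (tau s) (y s) (HD s)).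
  intros P [d HP].
  assert (H1 := proj1 (filterlim_locally tau (tau s)) Ht d).
  assert (H2 := proj1 (filterlim_locally y (y s)) Hy d).
  unfold filtermap; refine (filter_imp _ _ _ (filter_and _ _ H1 H2)).
  intros r [Hr1 Hr2]; apply HP; [split; trivial|apply HD].
Qed.

Theorem theorem3p4
  (X Y : CompleteNormedModule R_AbsRing)
  (J : Y -> X)                 (* continuous embedding of Y into X *)
  (leX : X -> X -> Prop)        (* order of X; Y carries the induced order *)
  (T : Rbar)
  (S : R -> X -> X) (DG : X -> Prop) (G : X -> X)
  (eta : R -> R)
  (F : R -> Y -> X)
  (H : Y -> X)
  (* Y is continuously embedded in X *)
  (HJlin : linear_map J)
  (HJinj : forall y1 y2, J y1 = J y2 -> y1 = y2)
  (HJbd : exists C : R, forall y, norm (J y) <= C * norm y)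
  (HT : Rbar_lt 0 T)
  (* (a) *)
  (HS : C0_semigroup S)
  (HG : generator S (fun x l => DG x /\ l = G x))
  (HSY : forall y, exists f : R -> Y,
      (forall t, 0 <= t -> J (f t) = S t (J y)) /\
      (forall t, 0 <= t ->
         filterlim f (within (fun r => 0 <= r) (locally t)) (locally (f t))))
  (* (b) *)
  (Heta_pos : forall d, 0 < d -> 0 < eta d)
  (Heta_lim : filterlim eta (at_right 0) (locally 0))
  (Hb : forall (s0 s1 : R) (phi : R -> X), 0 <= s0 -> s0 < s1 ->
      (forall s, s0 <= s <= s1 ->
         filterlim phi (within (fun r => s0 <= r <= s1) (locally s))
           (locally (phi s))) ->
      exists y : Y,
        J y = RInt (fun s => S (s1 - s) (phi s)) s0 s1 /\
        (forall M : R, (forall s, s0 <= s <= s1 -> norm (phi s) <= M) ->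
           norm y <= eta (s1 - s0) * M))
  (* (c) *)
  (HFcont : forall (t : R) (y : Y), 0 <= t -> Rbar_lt t T ->
      filterlim (fun p : R * Y => F (fst p) (snd p))
        (within (fun p : R * Y => 0 <= fst p /\ Rbar_lt (fst p) T)
           (locally (t, y)))
        (locally (F t y)))
  (HFlip : forall t', 0 <= t' -> Rbar_lt t' T -> forall r, 0 < r ->
      exists L : R, forall (t : R) (f g : Y), 0 <= t <= t' ->
        norm f <= r -> norm g <= r ->
        norm (minus (F t f) (F t g)) <= L * norm (minus f g))
  (* (d) *)
  (HXlat : banach_lattice leX)
  (HYlat : banach_lattice (fun y1 y2 : Y => leX (J y1) (J y2)))
  (HYsub : forall y1 y2, exists z, is_sup leX (J y1) (J y2) (J z))
  (HDGY : forall x, DG x -> exists y, J y = x)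
  (HDGdense : forall (y : Y) (eps : R), 0 < eps ->
      exists y' : Y, DG (J y') /\ norm (minus y y') < eps)
  (* (e) *)
  (HHlin : linear_map H)
  (HHpos : forall y, leX zero (J y) -> leX zero (H y))
  (HSgam : forall gam : R, 0 <= gam ->
      exists Sg : R -> X -> X,
        C0_semigroup Sg /\
        generator Sg (fun x l => DG x /\
           exists y, J y = x /\ l = minus (G x) (scal gam (H y))) /\
        positive_semigroup leX Sg /\
        (forall t y, 0 <= t -> exists y', J y' = Sg t (J y)))
  (* (f) *)
  (Hf : forall tau r, 0 <= tau -> Rbar_lt tau T -> 0 < r ->
      exists gam : R, 0 <= gam /\
        forall (t : R) (v : Y), leX zero (J v) -> norm v <= r -> 0 <= t <= tau ->
          leX zero (plus (F t v) (scal gam (H v))))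
  (* initial datum and maximal mild solution *)
  (u0 : Y) (Hu0 : leX zero (J u0))
  (tmax : Rbar) (u : R -> Y)
  (Htmax : Rbar_lt 0 tmax /\ Rbar_le tmax T)
  (Hu : maximal_mild_solution J S F T u0 tmax u) :
  forall t, 0 <= t -> Rbar_lt t tmax -> leX zero (J (u t)).
Proof.
  destruct Hu as [[Hucont Humild] _].
  assert (HJ : bounded_linear J) by (split; trivial).
  assert (HHbl : bounded_linear H).
  { apply (positive_operator_bounded (complete_sequentially Y) leX
      (fun y1 y2 : Y => leX (J y1) (J y2)) H HXlat HYlat HHlin).
    intros y Hy; apply HHpos; assert (E : J zero = zero) by exact (linear_map_zero J HJlin).
    rewrite <- E; exact Hy. }
  intros t Ht0 Httmax.
  (* On the compact interval [[0, t1]] the solution is bounded, which fixes [r], and through it [L]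
     and [gam]. *)
  assert (Ht1 : exists t1, t < t1 /\ Rbar_lt t1 tmax).
  { destruct tmax as [r| |]; simpl in Httmax; [|exists (t + 1); simpl; split; trivial; lra|easy].
    exists ((t + r) / 2); simpl; lra. }
  destruct Ht1 as (t1 & Htt1 & Ht1max).
  assert (Hlt : forall s, s <= t1 -> Rbar_lt s tmax).
  { intros s Hs; now apply Rbar_le_lt_trans with t1. }
  assert (HltT : forall s, s <= t1 -> Rbar_lt s T).
  { intros s Hs; apply Rbar_lt_le_trans with tmax; [now apply Hlt|apply Htmax]. }
  pose proof (clamp_bounds t1) as Hcl.
  assert (Huc : forall s, continuous (fun s => u (clamp t1 s)) s).
  { intros s; apply filterlim_comp with (f := clamp t1) (g := u)
      (2 := Hucont (clamp t1 s) (proj1 (Hcl s ltac:(lra))) (Hlt _ (proj2 (Hcl s ltac:(lra))))).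
    intros P HP; pose proof (continuous_clamp t1 s _ HP) as Hc; revert Hc.
    unfold filtermap; apply filter_imp; intros q Hq; apply Hq.
    split; [apply Hcl; lra|apply Hlt, Hcl; lra]. }
  set (uc := fun s => u (clamp t1 s)) in Huc.
  set (leY := fun y1 y2 : Y => leX (J y1) (J y2)).
  destruct (norm_bounded_on_segment uc 0 t1 Huc) as (r & Hr & Hur0).
  assert (Hur : forall s, norm (uc s) <= r).
  { intros s; replace (uc s) with (uc (clamp t1 s)).
    - apply Hur0, Hcl; lra.
    - unfold uc; now rewrite (clamp_id t1 (clamp t1 s)) by (apply Hcl; lra). }
  assert (Hupr : forall s, norm (pos_part leY (uc s)) <= r).
  { intros s; apply Rle_trans with (2 := Hur s), (norm_pos_part_le leY HYlat). }
  destruct (HFlip t1 ltac:(lra) (HltT t1 (Rle_refl _)) r Hr) as [L HL].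
  destruct (Hf t1 r ltac:(lra) (HltT t1 (Rle_refl _)) Hr) as (gam & Hgam & Hfgam).
  destruct (bounded_linear_bound H HHbl) as (KH & HKH & HHb).
  set (K := Rmax 0 L + gam * KH).
  assert (HK : 0 <= K).
  { pose proof (Rmax_l 0 L); assert (0 <= gam * KH) by (apply Rmult_le_pos; lra); unfold K; lra. }
  (* [K + 1] in place of [K] avoids dividing by zero. *)
  assert (Hdel : exists del, 0 < del /\ eta del * K <= / 2).
  { destruct (proj1 (at_right_eps (V := R_NormedModule) eta 0) Heta_lim (/ (2 * (K + 1))))
      as (d0 & Hd0 & Heta); [apply Rinv_0_lt_compat; lra|].
    exists (d0 / 2); split; [lra|].
    specialize (Heta (d0 / 2) ltac:(lra)); specialize (Heta_pos (d0 / 2) ltac:(lra)).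
    change (Rabs (eta (d0 / 2) - 0) < / (2 * (K + 1))) in Heta.
    rewrite Rminus_0_r, Rabs_pos_eq in Heta by lra.
    apply Rle_trans with (/ (2 * (K + 1)) * (K + 1)).
    - apply Rmult_le_compat; lra.
    - right; field; lra. }
  destruct Hdel as (del & Hdel & Hsmall).
  set (f0 := fun s => F (clamp t1 s) (uc s)).
  assert (HD : forall s, 0 <= clamp t1 s /\ Rbar_lt (clamp t1 s) T).
  { intros s; split; [|apply HltT]; apply Hcl; lra. }
  assert (HFc : forall (tau : R -> R) (y : R -> Y), (forall s, continuous tau s) ->
    (forall s, continuous y s) -> forall s, continuous (fun s => F (clamp t1 (tau s)) (y s)) s).
  { intros tau y Htau Hy s.
    apply (continuous_time_dependent F (fun t => 0 <= t /\ Rbar_lt t T)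
      (fun t y H => HFcont t y (proj1 H) (proj2 H)) (fun s => clamp t1 (tau s)) y s
      (fun s => HD (tau s))); [|apply Hy].
    apply (continuous_comp tau (clamp t1)); [apply Htau|apply continuous_clamp]. }
  assert (Hf0 : forall s, continuous f0 s).
  { apply (HFc (fun s => s) uc); trivial; intros s; apply continuous_id. }
  assert (Hmild : forall s, 0 <= s <= t1 -> J (u s) = duhamel S (J u0) f0 s).
  { intros s Hs; rewrite Humild by (try apply Hlt; lra); unfold duhamel.
    rewrite sg_ext_nneg by lra; f_equal; apply RInt_ext.
    intros q; rewrite Rmin_left, Rmax_right by lra; intros Hq.
    unfold f0, uc; now rewrite sg_ext_nneg, clamp_id by lra. }
  (* Steps of [del / 2], because [nneg_step] concludes only on a half-open interval of length at
     most [del]. *)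
  assert (Hall : forall (n : nat) s, 0 <= s < t1 -> s <= INR n * (del / 2) -> leX zero (J (u s))).
  { induction n as [|n IH]; intros s Hs Hsn.
    - simpl in Hsn; replace s with 0 by lra.
      rewrite Hmild by lra; now rewrite (duhamel_zero S HS).
    - rewrite S_INR in Hsn.
      set (a := Rmax 0 (s - del / 2)).
      assert (Ha : 0 <= a <= s /\ s - a <= del / 2 /\ a <= INR n * (del / 2)).
      { pose proof (pos_INR n); assert (0 <= INR n * (del / 2)) by (apply Rmult_le_pos; lra).
        unfold a, Rmax; destruct (Rle_dec 0 (s - del / 2)); lra. }
      specialize (IH a ltac:(lra) ltac:(lra)).
      (* Restarts the clock at [a] and freezes it there for [q <= 0], where the solution keeps the
         value [u a], non-negative by induction. *)
      set (tau := fun q => a + Rmax 0 q).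
      assert (Htau : forall q, continuous tau q).
      { intros q; apply (continuous_plus (V := R_NormedModule) (fun _ => a) (Rmax 0));
          [apply continuous_const|apply continuous_pos_part]. }
      assert (Huct : forall q, continuous (fun q => uc (tau q)) q).
      { intros q; apply (continuous_comp tau uc); auto. }
      assert (Hclamp : forall q, clamp t1 (tau q) <= t1) by (intros; apply Hcl; lra).
      replace (u s) with (uc (tau (s - a))).
      2: { unfold uc, tau; f_equal; rewrite Rmax_right by lra.
           rewrite clamp_id by lra; ring. }
      apply (nneg_step J H leX S eta HJ HJinj HS Hb DG G HG HXlat HYlat HHbl HHpos)
        with (f := fun q => F (clamp t1 (tau q)) (uc (tau q)))
             (fp := fun q => F (clamp t1 (tau q)) (pos_part leY (uc (tau q))))
             (uc := fun q => uc (tau q))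
             (gam := gam) (L := Rmax 0 L) (KH := KH) (del := del) (b := Rmin del (t1 - a));
        trivial; try lra.
      + intros g Hg; destruct (HSgam g Hg) as (Sg & H1 & H2 & H3 & _); now exists Sg.
      + apply Rmax_l.
      + auto.
      + apply Rmin_l.
      + now apply HFc.
      + apply HFc; trivial; intros q; now apply (continuous_pos_part_comp leY HYlat).
      + intros q Hq; unfold uc, tau; rewrite Rmax_left, Rplus_0_r, clamp_id by lra; trivial.
      + intros q; apply Rle_trans with (1 := HL _ _ _ (conj (proj1 (HD _)) (Hclamp q)) (Hur _) (Hupr _)).
        apply Rmult_le_compat_r; [apply norm_nneg|apply Rmax_r].
      + intros q; apply Hfgam; [|apply Hupr|split; [apply HD|trivial]].
        assert (E : J zero = zero) by exact (linear_map_zero J (proj1 HJ)).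
        rewrite <- E; apply (pos_part_nneg leY HYlat).
      + intros q Hq; assert (Hq2 : q < t1 - a) by (apply Rlt_le_trans with (1 := proj2 Hq), Rmin_r).
        assert (E : uc (tau q) = u (a + q)).
        { unfold uc, tau; now rewrite Rmax_right, clamp_id by lra. }
        assert (E0 : uc (tau 0) = u a).
        { unfold uc, tau; now rewrite Rmax_right, Rplus_0_r, clamp_id by lra. }
        rewrite E, E0, !Hmild, (duhamel_restart S HS) by (trivial; lra).
        unfold duhamel at 1 3; f_equal; apply RInt_ext.
        intros p; rewrite Rmin_left, Rmax_right by lra; intros Hp.
        unfold f0, tau; now rewrite (Rmax_right 0 p) by lra.
      + split; [lra|]; apply Rmin_glb_lt; lra. }
  destruct (INR_unbounded (t / (del / 2))) as [n Hn].
  apply (Hall n t); [lra|].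
  replace t with (t / (del / 2) * (del / 2)) by (field; lra).
  apply Rmult_le_compat_r; lra.
Qed.
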